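(* For an integer $k\ge 1$, let $d=2^k$, let $\mu$ be a primitive $(4d-2)$-th root of unity, $K=\mathbb{Q}(\mu)$ with ring of integers $\mathcal{O}_K$, and $f(x)=x^{2d}+2\mu x^d$. Then the following hold: 1. The set of all $a\in\mathcal{O}_K$ such that $(f(x),a)$ is dynamically irreducible, the ideals $(a)$ and $(a+\mu^2)$ are squarefree, and $f(a)-a$ is not divisible by $\mathfrak{p}^2$ for any prime ideal $\mathfrak{p}$ of $\mathcal{O}_K$ above $2$, is a positive density subset of $\mathcal{O}_K$. 2. For all $a\in\mathcal{O}_K$ such that $(f(x),a)$ is dynamically irreducible, the ideals $(a)$ and $(a+\mu^2)$ are squarefree, and $f(a)-a$ is not divisible by $\mathfrak{p}^2$ for any prime ideal $\mathfrak{p}$ of $\mathcal{O}_K$ above $2$, the pair $(f(x),a)$ is dynamically monogenic over $K$.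
   Context: $f^n$ denotes the $n$-fold composition of $f$. The pair $(f(x),a)$ is dynamically irreducible if $f^n(x)-a$ is irreducible over $K$ for every $n\ge 1$. A monic polynomial over $\mathcal{O}_K$ is monogenic (over $K$) if it is irreducible over $K$ and $\mathcal{O}_K[\alpha]=\mathcal{O}_{K(\alpha)}$ for a root $\alpha$; the pair $(f(x),a)$ is dynamically monogenic over $K$ if $f^n(x)-a$ is monogenic over $K$ for every $n\ge1$. An ideal of $\mathcal{O}_K$ is squarefree if it is nonzero and not divisible by $\mathfrak{q}^2$ for any prime ideal $\mathfrak{q}$. Density: fix an integral basis of $\mathcal{O}_K$ and let $\|a\|$ be the maximum of the absolute values of the coordinates of $a$; a subset $A\subseteq\mathcal{O}_K$ has positive density if $\liminf_{B\to\infty}\#\{a\in A:\|a\|\le B\}/\#\{a\in\mathcal{O}_K:\|a\|\le B\}>0$. *)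

(* Defs.v *)
From HB Require Import structures.
From mathcomp Require Import all_boot all_order all_algebra all_field.
From mathcomp Require Import finmap.
From mathcomp Require Import all_classical all_reals all_analysis.

Set Implicit Arguments.
Unset Strict Implicit.
Unset Printing Implicit Defensive.

Import Order.TTheory GRing.Theory Num.Theory.
Import numFieldNormedType.Exports.

Local Open Scope classical_set_scope.
Local Open Scope ring_scope.

Definition integers (F : fieldType) : set F :=
  [set x | integralOver (intr : int -> F) x].
Arguments integers F : clear implicits.

(** Ideals of the ring of integers of [F], as subsets of [F]; the unit ideal
    and the zero ideal are both allowed. *)
Section Ideals.
Variable F : fieldType.
Implicit Types (I J P : set F) (x y r : F).

Definition is_ideal I : Prop :=
  [/\ I `<=` integers F,
      I 0,
      forall x y, I x -> I y -> I (x + y) &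
      forall r x, integers F r -> I x -> I (r * x)].

Definition prime_ideal P : Prop :=
  [/\ is_ideal P,
      ~ P 1 &
      forall x y, integers F x -> integers F y -> P (x * y) -> P x \/ P y].

Definition principal x : set F := [set r * x | r in integers F].

Definition ideal_mul I J : set F :=
  [set z | exists (n : nat) (u v : 'I_n -> F),
     [/\ forall i, I (u i), forall i, J (v i) & z = \sum_(i < n) u i * v i]].

Definition ideal_dvd I J : Prop :=
  exists2 H, is_ideal H & J = ideal_mul I H.

(** Letting [Q] be the zero ideal changes nothing here: its square divides
    only the zero ideal. *)
Definition squarefree_ideal I : Prop :=
  I <> [set 0] /\
  forall Q, prime_ideal Q -> ~ ideal_dvd (ideal_mul Q Q) I.

Definition lies_above P (p : int) : Prop :=
  [set m : int | P m%:~R] = [set m : int | (p %| m)%Z].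

End Ideals.

Section Dynamics.
Variable K : fieldExtType rat.
Implicit Types (p f : {poly K}) (a : K).

Definition poly_iter f (n : nat) : {poly K} :=
  iter n (fun g => f \Po g) 'X.

Definition dynamically_irreducible f a : Prop :=
  forall n : nat, (1 <= n)%N -> irreducible_poly (poly_iter f n - a%:P).

(** [L] is any extension of [K] containing a root [alpha], and
    [<<1; alpha>>] is the subfield [K(alpha)] of [L]. *)
Definition monogenic p : Prop :=
  [/\ p \is monic,
      forall i : nat, integers K p`_i,
      irreducible_poly p &
      exists (L : fieldExtType K) (alpha : L),
        root (map_poly (in_alg L) p) alpha /\
        [set z : L | exists2 q : {poly K},
             forall i : nat, integers K q`_i &
             z = (map_poly (in_alg L) q).[alpha]]
        = [set z : L | z \in <<1; alpha>>%VS /\ integers L z]].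

Definition dynamically_monogenic f a : Prop :=
  forall n : nat, (1 <= n)%N -> monogenic (poly_iter f n - a%:P).

End Dynamics.

Section Density.
Variable K : fieldExtType rat.

Definition integral_basis (n : nat) (b : n.-tuple K) : Prop :=
  free b /\
  integers K = [set x | exists c : 'I_n -> int, x = \sum_(i < n) b`_i *~ c i].

Definition coord_norm (n : nat) (b : n.-tuple K) (a : K) : rat :=
  \big[Num.max/0]_(i < n) `|coord b i a|.

(** [fset_set] is meaningful only on finite sets; this one is finite as soon
    as [b] is an integral basis and [A] consists of integers. *)
Definition box_count (R : realType) (n : nat) (b : n.-tuple K)
    (A : set K) (B : R) : nat :=
  #|` fset_set [set a | A a /\ ratr (coord_norm b a) <= B]|.

Definition positive_density (R : realType) (n : nat) (b : n.-tuple K)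
    (A : set K) : Prop :=
  A `<=` integers K /\
  (0 < limf_einf
         (fun B : R =>
            ((box_count b A B)%:R / (box_count b (integers K) B)%:R : R)%:E)
         (pinfty_nbhs R))%E.

End Density.

Definition admissible (K : fieldExtType rat) (mu : K) (f : {poly K}) : set K :=
  [set a | [/\ integers K a,
     dynamically_irreducible f a,
     squarefree_ideal (principal a),
     squarefree_ideal (principal (a + mu ^+ 2)) &
     forall P : set K, prime_ideal P -> lies_above P 2 ->
       ~ ideal_dvd (ideal_mul P P) (principal (f.[a] - a))]].

(* Main.v *)
Require Import Defs.
From HB Require Import structures.
From mathcomp Require Import all_boot all_order all_algebra all_field.
From mathcomp Require Import all_classical all_reals all_analysis.
From mathcomp Require Import ring lra zify.
From mathcomp Require Import perm.
From mathcomp Require cyclic.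

(** Write [A] for the ring of integers of [K], [d = 2 ^ k], [D = (2 * d) ^ n] and
    [w = mu ^ 2], a primitive root of unity of odd order [m = 2 * d - 1].

    The second part.  Since [f(x) + mu ^ 2 = (x ^ d + mu) ^ 2], the critical values
    of [f] are [0] and [- mu ^ 2], and both are fixed by [f].  Let
    [f ^ n (alpha) = a].  Between [f ^ (i + 1) (alpha)] and [f ^ i (alpha)] the
    field grows by [k + 1] square roots: [s = f ^ i (alpha) ^ d + mu] is a square
    root of [f ^ (i + 1) (alpha) + mu ^ 2], and then [s - mu] is a [d]-th power.
    If [B / (s ^ 2)] is reduced, then [B' = B + B * s] is integrally closed away
    from [2] when [B] is, and [B' / (s - e)] is isomorphic to
    [B / (e ^ 2 - s ^ 2)] ([quadratic_step]).  All the quotients that occur are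
    isomorphic to [A / (a)] or [A / (a + mu ^ 2)], and these are reduced because
    the two ideals are squarefree ([squarefree_reduced]).  So a power of [2]
    multiplies every integer of [K(alpha)] into [A[alpha]] ([tower_stage],
    [stage_final]).
    Above [2] the residue fields have [2 * d] elements: [z ^ (2 * d) = z] modulo
    [2] on [A] ([frobenius2]).  Hence [f ^ n (x) - a] is [(x - a) ^ D] modulo [2],
    and the condition on [f(a) - a] makes it Eisenstein in [t = x - a]: [t ^ D] is
    [2] times a unit modulo [2] ([t_pow]), which removes the powers of [2]
    ([half_mem]).

    What is needed of the arithmetic of [A] comes from two facts: [m * A] is
    contained in the ring generated by [w] ([integral_span], by Fourier
    inversion), which gives Frobenius modulo every prime not dividing [m] and
    the finiteness of the quotients [A / (c)]; and an ideal that annihilates some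
    [v] modulo [x] and is maximal among such ideals is invertible
    ([squareful_principal]), which turns a nilpotent [v] of [A / (x)] into a prime
    ideal whose square divides [(x)].

    The first part.  It suffices to find enough admissible elements in one
    residue class.  If [a] is [2] modulo [4], then [f ^ n (x) - a] is Eisenstein
    at [2], hence irreducible ([irreducible_iter]), and no square of a prime above
    [2] divides [a], [a + mu ^ 2] or [f(a) - a].  If moreover [a] is [1] modulo
    every odd prime [p <= T], then [a] and [a + mu ^ 2] are units modulo [p], since
    [1 + mu ^ 2] is a unit.  There remain the primes [p > T], for which a sieve
    discards at most half of a large cube ([admissible_count]): the square of a
    prime ideal above [p] has at most one point of the class in each cell of side
    about [p ^ (2 / n)], because the norm of a difference would be a multiple of
    [p ^ 2]; there are at most [n] such ideals, and the sum of [1 / p ^ 2] over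
    [p > T] is at most [1 / T]. *)

Set Implicit Arguments.
Unset Strict Implicit.
Unset Printing Implicit Defensive.

Import Order.TTheory GRing.Theory Num.Theory.

Local Open Scope classical_set_scope.
Local Open Scope ring_scope.

(** * Integral elements *)

Section SubringClosure.

(* Restating the closure lemmas for one structure keeps every goal that they
   generate in the form [_ \in B]. *)
Variables (R : pzRingType) (B : subringClosed R).

Lemma subring0 : 0 \in B. Proof. exact: rpred0. Qed.
Lemma subring1 : 1 \in B. Proof. exact: rpred1. Qed.
Lemma subring_nat n : n%:R \in B. Proof. exact: rpred_nat. Qed.
Lemma subring_int (c : int) : c%:~R \in B. Proof. exact: rpred_int. Qed.
Lemma subringN x : x \in B -> - x \in B. Proof. exact: rpredNr. Qed.
Lemma subringD x y : x \in B -> y \in B -> x + y \in B.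
Proof. exact: rpredD. Qed.
Lemma subringB x y : x \in B -> y \in B -> x - y \in B.
Proof. exact: rpredB. Qed.
Lemma subringM x y : x \in B -> y \in B -> x * y \in B.
Proof. exact: rpredM. Qed.
Lemma subringX x n : x \in B -> x ^+ n \in B. Proof. exact: rpredX. Qed.

End SubringClosure.

Ltac rpred_closed := repeat (first [ assumption | exact: subring0 | exact: subring1
  | exact: subring_nat | exact: subring_int | apply: subringB | apply: subringD
  | apply: subringM | apply: subringN | apply: subringX ]).

(** As a predicate, so as to carry a subring structure. *)
Definition integral_elt (F : fieldType) : {pred F} := fun x => `[< integers F x >].
Arguments integral_elt F : clear implicits.

Lemma integral_eltP (F : fieldType) (x : F) :
  reflect (integers F x) (x \in integral_elt F).
Proof. exact: asboolP. Qed.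

Fact integral_elt_subring (F : fieldType) : subring_closed (integral_elt F).
Proof.
split.
- exact/integral_eltP/integral1.
- move=> x y /integral_eltP ix /integral_eltP iy.
  exact/integral_eltP/integral_sub.
- move=> x y /integral_eltP ix /integral_eltP iy.
  exact/integral_eltP/integral_mul.
Qed.

HB.instance Definition _ (F : fieldType) :=
  GRing.isSubringClosed.Build F (integral_elt F) (@integral_elt_subring F).

Lemma integral_eltE (F : fieldType) (p : {poly int}) (x : F) :
  p \is monic -> root (map_poly intr p) x -> x \in integral_elt F.
Proof. by move=> mp px; apply/integral_eltP; exists p. Qed.

Lemma integral_elt_root (F : fieldType) (p : {poly F}) (x : F) :
  p \is monic -> p \is a polyOver (integral_elt F) -> root p x ->
  x \in integral_elt F.
Proof.
move=> mp /polyOverP Ap px; apply/integral_eltP.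
apply: (integral_root_monic mp px); apply/integral_poly => i.
exact/integral_eltP.
Qed.

Lemma integral_elt_rmorph (F E : fieldType) (f : {rmorphism F -> E}) x :
  (f x \in integral_elt E) = (x \in integral_elt F).
Proof.
have fp (p : {poly int}) :
    map_poly intr p = map_poly f (map_poly intr p) :> {poly E}.
  by rewrite -map_poly_comp; apply: eq_map_poly => c /=; rewrite rmorph_int.
by apply/idP/idP => /integral_eltP[p mp px]; apply/integral_eltP; exists p;
  move: px; rewrite ?fp ?fmorph_root // fp fmorph_root.
Qed.

Lemma integral_rat (r : rat) : r \in integral_elt rat -> r \is a Num.int.
Proof.
move=> /integral_eltP[p mp pr]; rewrite -Cint_rat; apply: Cint_rat_Aint.
  exact: Crat_rat.
apply: (@root_monic_Aint (map_poly intr p)); first last.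
- by apply/polyOverP => i; rewrite coef_map /= intr_int.
- exact: monic_map.
have -> : map_poly intr p = map_poly ratr (map_poly (intr : int -> rat) p) :> {poly algC}.
  by rewrite -map_poly_comp; apply: eq_map_poly => c /=; rewrite rmorph_int.
by rewrite fmorph_root.
Qed.

Lemma integral_in_alg (L : fieldExtType rat) (x : L) :
  x \in 1%VS -> x \in integral_elt L -> exists c : int, x = c%:~R.
Proof.
move=> /vlineP[r ->]; rewrite (integral_elt_rmorph (in_alg L)) => /integral_rat.
move=> /intrP[c ->]; exists c.
by rewrite -[_ *: 1]/(in_alg L _) rmorph_int.
Qed.

(** * Cyclotomic fields *)

Section Cyclotomic.

Variables (K : fieldExtType rat) (m : nat) (w : K).
Hypotheses (w_prim : m.-primitive_root w) (w_gen : <<1; w>>%VS = fullv).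
Local Notation A := (integral_elt K).

Let m_gt0 : (0 < m)%N := prim_order_gt0 w_prim.

Lemma prim_root_integral : w \in A.
Proof.
apply: (@integral_eltE _ ('X^m - 1)); first exact: monicXnsubC.
rewrite rmorphB /= rmorph1 map_polyXn.
by rewrite rootE !hornerE prim_expr_order ?subrr.
Qed.

Lemma prim_root_sum (i j : nat) : (i < m)%N -> (j < m)%N ->
  \sum_(l < m) (w ^+ i / w ^+ j) ^+ l = (m * (i == j))%:R.
Proof.
move=> im jm; have w0 : w != 0 by rewrite (prim_root_eq0 w_prim) -lt0n.
have [<-|nij] := eqVneq i j.
  rewrite muln1 divff ?expf_neq0 //.
  by under eq_bigr do rewrite expr1n; rewrite sumr_const card_ord.
rewrite muln0; apply/eqP.
have : (w ^+ i / w ^+ j) ^+ m - 1 == 0.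
  rewrite expr_div_n -!exprM mulnC [(j * m)%N]mulnC !exprM.
  by rewrite !(prim_expr_order w_prim) !expr1n divr1 subrr.
rewrite subrX1 mulf_eq0 => /orP[|//].
rewrite subr_eq0 => /eqP h; have /eqP := divr1_eq h.
by rewrite (eq_prim_root_expr w_prim) !modn_small // (negPf nij).
Qed.

(** Multiply a rational polynomial representing [z] by the idempotent of the
    component [K] of [Q[X] / (X ^ m - 1)]: at a power of [w] it then takes either
    the value zero or a conjugate of [z]. *)
Lemma integral_poly_values (z : K) : z \in A ->
  exists2 q : {poly K}, q \is a polyOver 1%VS /\ (size q <= m)%N &
  q.[w] = z /\ forall i : nat, q.[w ^+ i] \in A.
Proof.
move=> Az; pose P := minPoly 1 w; pose X := 'X^m - 1 : {poly K}.
have PQ : P \is a polyOver 1%VS by exact: minPolyOver.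
have XQ : X \is a polyOver 1%VS by rewrite rpredB ?rpredX ?polyOverX ?rpred1.
have Xw i : X.[w ^+ i] = 0.
  by rewrite !hornerE exprAC (prim_expr_order w_prim) expr1n subrr.
have PX : P %| X by apply: minPoly_dvdp => //; apply/rootP; rewrite -(expr1 w).
pose h := X %/ P; have hQ : h \is a polyOver 1%VS by exact: divp_polyOver.
have XPh : X = h * P by rewrite divpK.
have hw : h.[w] != 0.
  apply/negP => /eqP hw0; have := congr1 (fun p => (p^`()).[w]) XPh.
  rewrite derivM hornerD !hornerM hw0 minPolyxx mulr0 mul0r addr0.
  rewrite derivB derivXn derivC subr0 hornerMn hornerXn => /eqP.
  rewrite -mulr_natl mulf_eq0 expf_eq0 (prim_root_eq0 w_prim).
  by rewrite (negPf (prim_root_natf_neq0 w_prim)) eqn0Ngt m_gt0 andbF.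
have gen (x : K) : exists2 p, p \is a polyOver 1%VS & p.[w] = x.
  have : x \in <<1; w>>%VS by rewrite w_gen memvf.
  by move=> /Fadjoin_polyP[p pQ ->]; exists p.
have [W WQ Ww] := gen (h.[w])^-1; have [q0 q0Q q0w] := gen z.
pose q1 := q0 * h * W.
have q1Q : q1 \is a polyOver 1%VS by rewrite !rpredM.
have q1w : q1.[w] = z by rewrite !hornerM q0w Ww mulfK.
have X0 : X != 0 by rewrite -size_poly_eq0 size_XnsubC.
have qq i : (q1 %% X).[w ^+ i] = q1.[w ^+ i].
  by rewrite [in RHS](divp_eq q1 X) hornerD hornerM Xw mulr0 add0r.
exists (q1 %% X); first split.
- by rewrite modp_polyOver.
- by rewrite -ltnS -(size_XnsubC (1 : K) m_gt0) ltn_modp.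
split=> [|i]; first by rewrite -[w]expr1 qq expr1.
rewrite qq; have := Xw i; rewrite XPh hornerM => /eqP.
rewrite mulf_eq0 => /orP[/eqP hi|/eqP Pi].
  by rewrite /q1 !hornerM hi mulr0 mul0r rpred0.
have /integral_eltP[p mp pz] := Az.
pose pK := map_poly intr p : {poly K}.
apply: (@integral_eltE _ p) => //.
have : P %| pK \Po q1.
  apply: minPoly_dvdp; last by rewrite rootE horner_comp q1w.
  apply: polyOver_comp => //; apply/polyOverP => j.
  by rewrite coef_map rpred_int.
move=> /dvdpP[u uE]; rewrite rootE -/pK -horner_comp uE hornerM Pi mulr0.
by [].
Qed.

(** Fourier inversion on the powers of [w]: [m] times a coefficient of the
    polynomial above is both rational and integral. *)
Lemma integral_span (z : K) : z \in A ->
  exists c : 'I_m -> int, m%:R * z = \sum_(j < m) (c j)%:~R * w ^+ j.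
Proof.
move=> /integral_poly_values[q [qQ szq] [<- qA]].
have w0 : w != 0 by rewrite (prim_root_eq0 w_prim) -lt0n.
have coefE j : (j < m)%N -> \sum_(i < m) q.[w ^+ i] / w ^+ i ^+ j = m%:R * q`_j.
  move=> jm; transitivity (\sum_(i < m) \sum_(l < m) q`_l * (w ^+ l / w ^+ j) ^+ i).
    apply: eq_bigr => i _; rewrite (horner_coef_wide _ szq) mulr_suml.
    apply: eq_bigr => l _; rewrite expr_div_n -mulrA -!exprM.
    by rewrite ![(i * _)%N]mulnC.
  rewrite exchange_big /= (bigD1 (Ordinal jm)) //= -mulr_sumr prim_root_sum //.
  rewrite eqxx muln1 big1 ?addr0 1?mulrC // => l lj.
  have ljN : (l == j :> nat) = false := negbTE lj.
  by rewrite -mulr_sumr prim_root_sum // ljN muln0 mulr0.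
have wV : w^-1 \in A.
  have -> : w^-1 = w ^+ m.-1.
    by apply: (mulfI w0); rewrite mulfV // -exprS prednK // prim_expr_order.
  by rewrite rpredX ?prim_root_integral.
have cint j : (j < m)%N -> exists c : int, m%:R * q`_j = c%:~R.
  move=> jm; apply: integral_in_alg.
    by rewrite rpredM ?rpred_nat // (polyOverP qQ).
  rewrite -coefE //; apply: rpred_sum => i _.
  by rewrite rpredM ?qA // -!exprVn !rpredX.
have /choice[c cE] (j : 'I_m) : exists c : int, m%:R * q`_j = c%:~R by exact: cint.
exists c; rewrite (horner_coef_wide _ szq) mulr_sumr.
by apply: eq_bigr => j _; rewrite mulrA cE.
Qed.

End Cyclotomic.

(** * Divisibility inside a subring *)

Definition dvd_in (F : fieldType) (B : {pred F}) (x y : F) : Prop :=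
  exists2 q, q \in B & y = q * x.

Section DvdIn.

Variables (F : fieldType) (B : subringClosed F).
Implicit Types x y z : F.

Lemma dvd_in0 x : dvd_in B x 0.
Proof. by exists 0; rewrite ?rpred0 ?mul0r. Qed.

Lemma dvd_in_refl x : dvd_in B x x.
Proof. by exists 1; rewrite ?rpred1 ?mul1r. Qed.

Lemma dvd_in_mull x y b : b \in B -> dvd_in B x y -> dvd_in B x (b * y).
Proof. by move=> Bb [q Bq ->]; exists (b * q); rewrite ?rpredM ?mulrA. Qed.

Lemma dvd_in_mulr x y b : b \in B -> dvd_in B x y -> dvd_in B x (y * b).
Proof. by rewrite mulrC; apply: dvd_in_mull. Qed.

Lemma dvd_in_add x y z : dvd_in B x y -> dvd_in B x z -> dvd_in B x (y + z).
Proof. by move=> [q Bq ->] [r Br ->]; exists (q + r); rewrite ?rpredD ?mulrDl. Qed.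

Lemma dvd_in_opp x y : dvd_in B x y -> dvd_in B x (- y).
Proof. by move=> [q Bq ->]; exists (- q); rewrite ?rpredN ?mulNr. Qed.

Lemma dvd_in_sub x y z : dvd_in B x y -> dvd_in B x z -> dvd_in B x (y - z).
Proof. by move=> xy xz; apply/dvd_in_add/dvd_in_opp. Qed.

Lemma dvd_in_trans x y z : dvd_in B x y -> dvd_in B y z -> dvd_in B x z.
Proof. by move=> xy [q Bq ->]; apply: dvd_in_mull. Qed.

Lemma dvd_in_mul x y u v : dvd_in B x u -> dvd_in B y v -> dvd_in B (x * y) (u * v).
Proof.
by move=> [q Bq ->] [r Br ->]; exists (q * r); rewrite ?rpredM // mulrACA.
Qed.

Lemma dvd_in_sum x n (f : 'I_n -> F) :
  (forall i, dvd_in B x (f i)) -> dvd_in B x (\sum_i f i).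
Proof.
move=> xf; apply: (big_ind (dvd_in B x)) => //; first exact: dvd_in0.
exact: dvd_in_add.
Qed.

Lemma dvd_in_subX x y z n : y \in B -> z \in B ->
  dvd_in B x (y - z) -> dvd_in B x (y ^+ n - z ^+ n).
Proof.
move=> By Bz xyz; rewrite subrXX; apply: dvd_in_mulr => //.
by apply: rpred_sum => i _; rewrite rpredM ?rpredX.
Qed.

Lemma exprD_prime p x y : prime p -> x \in B -> y \in B ->
  dvd_in B p%:R ((x + y) ^+ p - (x ^+ p + y ^+ p)).
Proof.
case: p => // p p_pr Bx By.
rewrite exprDn big_ord_recl big_ord_recr /= /bump /= subn0 subnn !expr0.
rewrite mulr1 mul1r bin0 binn !mulr1n; set s := \sum_(i < p) _.
have -> : x ^+ p.+1 + (s + y ^+ p.+1) - (x ^+ p.+1 + y ^+ p.+1) = s by ring.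
apply: dvd_in_sum => i; rewrite add1n -[_ *+ 'C(_, _)]mulr_natr.
apply: dvd_in_mull; first by rewrite rpredM ?rpredX.
have /dvdnP[c ->] : (p.+1 %| 'C(p.+1, i.+1))%N.
  by apply: prime_dvd_bin => //=; have := ltn_ord i; lia.
by exists c%:R; rewrite ?rpred_nat ?natrM.
Qed.

Lemma exprD_prime_pow p r x y : prime p -> x \in B -> y \in B ->
  dvd_in B p%:R ((x + y) ^+ (p ^ r) - (x ^+ (p ^ r) + y ^+ (p ^ r))).
Proof.
move=> p_pr Bx By; elim: r => [|r IHr]; first by rewrite !expr1 subrr; apply: dvd_in0.
rewrite expnSr !exprM.
have h1 := dvd_in_subX p (rpredX _ (rpredD Bx By))
  (rpredD (rpredX _ Bx) (rpredX _ By)) IHr.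
have h2 := exprD_prime p_pr (rpredX (p ^ r) Bx) (rpredX (p ^ r) By).
by have := dvd_in_add h1 h2; rewrite addrA subrK.
Qed.

End DvdIn.

Lemma principalE (F : fieldType) (x y : F) :
  principal x y <-> dvd_in (integral_elt F) x y.
Proof.
split=> [[r /integral_eltP Ar <-]|[r /integral_eltP Ar ->]]; first by exists r.
by exists r.
Qed.

Lemma natr_field_neq0 (K : fieldExtType rat) n : (0 < n)%N -> n%:R != 0 :> K.
Proof.
move=> n_gt0; rewrite -(rmorph_nat (in_alg K)) fmorph_eq0 pnatr_eq0.
by rewrite -lt0n.
Qed.

(** Dividing a monic integral equation of a nonzero element by a power of the
    unknown makes its constant term nonzero. *)
Lemma integral_dvd_nat (K : fieldExtType rat) (x : K) :
  x \in integral_elt K -> x != 0 ->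
  exists2 c : nat, (0 < c)%N & dvd_in (integral_elt K) x c%:R.
Proof.
move=> Ax x0; have /integral_eltP[p mp px] := Ax.
have [n] := ubnP (size p); elim: n p mp px => // n IHn p mp px lepn.
case: (eqVneq p`_0 0) => [p0|p0]; last first.
  pose q := \poly_(i < (size p).-1) p`_i.+1.
  have pE : p = q * 'X + (p`_0)%:P.
    apply/polyP => i; rewrite coefD coefMX coefC; case: i => [|i] /=.
      by rewrite add0r.
    rewrite addr0 coef_poly; case: ltnP => // h; rewrite nth_default //.
    by move: h; case: (size p).
  have pxE : (map_poly intr q).[x] * x = - (p`_0)%:~R.
    move/rootP: px; rewrite {1}pE rmorphD rmorphM /= map_polyX map_polyC /=.
    by rewrite !hornerE => /eqP; rewrite addr_eq0 => /eqP.
  have Aq : (map_poly intr q).[x] \in integral_elt K.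
    apply: rpred_horner => //; apply/polyOverP => i.
    by rewrite coef_map rpred_int.
  move: p0 pxE; set e : int := nth _ _ _ => e0 pxE.
  exists (absz e); first by rewrite absz_gt0.
  have [s ->] : exists s : bool, (absz e)%:R = (-1) ^+ s * e%:~R :> K.
    exists (e < 0); rewrite -[(absz e)%:R]/((absz e)%:~R) abszE normrEsign.
    by rewrite rmorphM rmorph_sign.
  exists ((-1) ^+ s * - (map_poly intr q).[x]).
    by rewrite rpredM ?rpredX ?rpredN ?rpred1.
  by rewrite -mulrA mulNr pxE opprK.
have : root p 0 by rewrite rootE horner_coef0 p0.
move=> /factor_theorem[q]; rewrite subr0 => pE.
have mq : q \is monic by move: mp; rewrite pE monicMr ?monicX.
apply: (IHn q) => //.
  move: px; rewrite pE rmorphM /= map_polyX rootM rootX (negPf x0) orbF //.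
by move: lepn; rewrite pE size_Mmonic ?monicX ?monic_neq0 // size_polyX addn2.
Qed.

Lemma intr_field_inj (K : fieldExtType rat) : injective (intr : int -> K).
Proof.
move=> a b; rewrite -!(rmorph_int (in_alg K)) => /fmorph_inj; exact: intr_inj.
Qed.

Lemma dvd_in_int (K : fieldExtType rat) (p : nat) (c : int) : (0 < p)%N ->
  dvd_in (integral_elt K) p%:R c%:~R -> (p %| c)%Z.
Proof.
move=> p_gt0 [q Aq cE]; have p0 := natr_field_neq0 K p_gt0.
have [|e qE] := integral_in_alg _ Aq.
  have -> : q = c%:~R / p%:R by rewrite cE mulfK.
  by rewrite rpred_div ?rpred_int ?rpred_nat.
apply/dvdzP; exists e; apply: (@intr_field_inj K).
by rewrite cE qE rmorphM.
Qed.

(** * Frobenius and finiteness in a cyclotomic field *)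

Section CyclotomicFrobenius.

Variables (K : fieldExtType rat) (m : nat) (w : K).
Hypotheses (w_prim : m.-primitive_root w) (w_gen : <<1; w>>%VS = fullv).
Local Notation A := (integral_elt K).

(** The elements that satisfy the congruence form a ring containing [w], hence
    containing [m * z]; and [m] is invertible modulo [p]. *)
Lemma frobenius_cyclotomic p r z : prime p -> ~~ (p %| m)%N ->
  p ^ r = 1 %[mod m] -> z \in A -> dvd_in A p%:R (z ^+ (p ^ r) - z).
Proof.
move=> p_pr pm pr1 Az; pose S x := x \in A /\ dvd_in A p%:R (x ^+ (p ^ r) - x).
have SD x y : S x -> S y -> S (x + y).
  move=> [Ax xx] [Ay yy]; split; first exact: rpredD.
  have := dvd_in_add (exprD_prime_pow r p_pr Ax Ay) (dvd_in_add xx yy).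
  move: ((x + y) ^+ _) (x ^+ _) (y ^+ _) => a b c.
  by congr dvd_in; ring.
have SM x y : S x -> S y -> S (x * y).
  move=> [Ax xx] [Ay yy]; split; first exact: rpredM.
  have := dvd_in_add (dvd_in_mull (rpredX (p ^ r) Ay) xx) (dvd_in_mull Ax yy).
  rewrite exprMn; move: (x ^+ _) (y ^+ _) => a b.
  by congr dvd_in; ring.
have S0 : S 0.
  split; first exact: rpred0.
  by rewrite expr0n expn_eq0 -leqn0 leqNgt prime_gt0 // subrr; apply: dvd_in0.
have S1 : S 1.
  by split; rewrite ?rpred1 // expr1n subrr; apply: dvd_in0.
have SN x : S x -> S (- x).
  move=> [Ax xx]; split; first by rewrite rpredN.
  have := dvd_in_opp (dvd_in_add (exprD_prime_pow r p_pr Ax (_ : - x \in A)) xx).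
  rewrite rpredN subrr expr0n expn_eq0 -leqn0 leqNgt prime_gt0 //= => /(_ Ax).
  move: ((- x) ^+ _) (x ^+ _) => a b.
  by congr dvd_in; ring.
have Snat n : S n%:R.
  by elim: n => // n IHn; rewrite -natr1; apply: SD.
have Sint (c : int) : S c%:~R.
  case: c => n; first exact: Snat.
  by rewrite NegzE rmorphN; apply: SN; apply: Snat.
have Sw : S w.
  split; first exact: prim_root_integral w_prim.
  have /eqP -> : w ^+ (p ^ r) == w.
    by rewrite -[w in _ == w]expr1 (eq_prim_root_expr w_prim) pr1.
  by rewrite subrr; apply: dvd_in0.
have SX n : S (w ^+ n).
  by elim: n => [|n IHn]; rewrite ?expr0 // exprS; apply: SM.
have [c mz] := integral_span w_prim w_gen Az.
have [_ Smz] : S (m%:R * z).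
  by rewrite mz; apply: (big_ind S) => // i _; apply: (SM _ _ (Sint _) (SX _)).
have [_ Sm] := Snat m.
have : dvd_in A p%:R (m%:R * (z ^+ (p ^ r) - z)).
  have := dvd_in_sub Smz (dvd_in_mulr (rpredX (p ^ r) Az) Sm).
  rewrite exprMn; move: (z ^+ _) (m%:R ^+ _) => a b.
  by congr dvd_in; ring.
have Az' : z ^+ (p ^ r) - z \in A by rewrite rpredB ?rpredX.
move: (z ^+ _ - z) Az' => y Ay pmy.
have m_gt0 := prim_order_gt0 w_prim.
case: (egcdnP p m_gt0) => u v uv _.
have /eqP mp1 : coprime m p by rewrite coprime_sym prime_coprime.
rewrite mp1 in uv.
have := dvd_in_sub (dvd_in_mull (rpred_nat A u) pmy)
   (dvd_in_mull (rpredM (rpred_nat A v) Ay) (dvd_in_refl A p%:R)).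
congr dvd_in; rewrite mulrA -natrM uv natrD natrM; ring.
Qed.

(** The class of [y] modulo [c] is determined by the coordinates modulo [c * m]
    of [m * y] on the powers of [w]. *)
Lemma finite_residues c : (0 < c)%N -> exists (T : finType) (phi : K -> T),
  {in A &, forall y y', phi y = phi y' -> dvd_in A c%:R (y - y')}.
Proof.
move=> c_gt0; have m_gt0 := prim_order_gt0 w_prim.
have /choice[g gE] (y : K) : exists c : 'I_m -> int,
    y \in A -> m%:R * y = \sum_(j < m) (c j)%:~R * w ^+ j.
  have [Ay|//] := boolP (y \in A); last by exists (fun=> 0).
  by have [d] := integral_span w_prim w_gen Ay; exists d.
pose n := (c * m)%N; have n_gt0 : (0 < n)%N by rewrite muln_gt0 c_gt0.
exists {ffun 'I_m -> 'I_n.-1.+1}, (fun y => [ffun j => inord `|(g y j %% n)%Z|]).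
move=> y y' Ay Ay' /ffunP eqg.
have /choice[e eE] (j : 'I_m) : exists e : int, g y j - g y' j = e * n.
  have := congr1 val (eqg j); rewrite !ffunE /=.
  have bd (a : int) : (`|(a %% n)%Z| < n.-1.+1)%N.
    rewrite prednK // -ltz_nat gez0_abs ?modz_ge0 ?ltz_pmod //.
    by rewrite eqz_nat -lt0n.
  rewrite !inordK // => /(congr1 Posz).
  rewrite !gez0_abs ?modz_ge0 ?eqz_nat -?lt0n // => /eqP.
  by rewrite eqz_mod_dvd => /dvdzP[e ->]; exists e.
have m0 : m%:R != 0 :> K := natr_field_neq0 K m_gt0.
exists (\sum_(j < m) (e j)%:~R * w ^+ j).
  apply: rpred_sum => j _; rewrite rpredM ?rpred_int ?rpredX //.
  exact: prim_root_integral w_prim.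
apply: (mulfI m0); rewrite mulrBr (gE _ Ay) (gE _ Ay') -sumrB.
rewrite [RHS]mulrC -[RHS]mulrA -natrM mulr_suml; apply: eq_bigr => j _.
by rewrite -mulrBl -rmorphB /= eE rmorphM /= mulrAC.
Qed.

End CyclotomicFrobenius.

(** * Products of ideals *)

Section IdealMul.

Variable F : fieldType.
Local Notation A := (integral_elt F).
Implicit Types I J : set F.

Lemma ideal_mul_mem I J x y : I x -> J y -> ideal_mul I J (x * y).
Proof.
move=> Ix Jy; exists 1%N, (fun=> x), (fun=> y).
by rewrite big_ord1.
Qed.

Lemma ideal_mul_add I J x y :
  ideal_mul I J x -> ideal_mul I J y -> ideal_mul I J (x + y).
Proof.
move=> [n [u [v [Iu Jv ->]]]] [n' [u' [v' [Iu' Jv' ->]]]].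
pose glue (f : 'I_n -> F) (f' : 'I_n' -> F) (i : 'I_(n + n')) :=
  match fintype.split i with inl j => f j | inr j => f' j end.
exists (n + n')%N, (glue u u'), (glue v v'); split.
- by move=> i; rewrite /glue; case: fintype.split.
- by move=> i; rewrite /glue; case: fintype.split.
rewrite big_split_ord /=; congr (_ + _); apply: eq_bigr => i _.
  by rewrite /glue (unsplitK (inl _ i)).
by rewrite /glue (unsplitK (inr _ i)).
Qed.

Lemma ideal_mul_sub I J (P : set F) : P 0 ->
  (forall x y, P x -> P y -> P (x + y)) ->
  (forall x y, I x -> J y -> P (x * y)) -> ideal_mul I J `<=` P.
Proof.
move=> P0 PD PM _ [n [u [v [Iu Jv ->]]]].
by apply: (big_ind P) => // i _; apply: PM.
Qed.

Lemma prime_ideal_mul (Q : set F) x y : prime_ideal Q ->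
  x \in A -> y \in A -> Q (x * y) -> Q x \/ Q y.
Proof. by move=> [_ _ QP] /integral_eltP Ax /integral_eltP Ay; apply: QP. Qed.

Lemma ideal_int (Q : set F) x : is_ideal Q -> Q x -> x \in A.
Proof. by move=> [QA _ _ _] /QA /integral_eltP. Qed.

Lemma ideal_add (Q : set F) x y : is_ideal Q -> Q x -> Q y -> Q (x + y).
Proof. by move=> [_ _ QD _]; apply: QD. Qed.

Lemma ideal_mull (Q : set F) x y : is_ideal Q -> x \in A -> Q y -> Q (x * y).
Proof. by move=> [_ _ _ QM] /integral_eltP Ax; apply: QM. Qed.

Lemma ideal_mulr (Q : set F) x y : is_ideal Q -> Q x -> y \in A -> Q (x * y).
Proof. by rewrite mulrC => iQ Qx Ay; apply: ideal_mull. Qed.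

Lemma ideal_opp (Q : set F) x : is_ideal Q -> Q x -> Q (- x).
Proof. by move=> iQ Qx; rewrite -mulN1r; apply: ideal_mull; rewrite // rpredN rpred1. Qed.

Lemma ideal_sub (Q : set F) x y : is_ideal Q -> Q x -> Q y -> Q (x - y).
Proof. by move=> iQ Qx Qy; apply: ideal_add => //; apply: ideal_opp. Qed.

Lemma ideal_dvd_mem (Q : set F) x y : is_ideal Q -> Q x -> dvd_in A x y -> Q y.
Proof. by move=> iQ Qx [q Aq ->]; apply: ideal_mull. Qed.

Lemma ideal_mul_ideal I J : is_ideal I -> is_ideal J -> is_ideal (ideal_mul I J).
Proof.
move=> iI iJ; split.
- apply: ideal_mul_sub; first by apply/integral_eltP; rewrite rpred0.
    move=> x y /integral_eltP Ax /integral_eltP Ay; apply/integral_eltP.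
    exact: rpredD.
  move=> x y Ix Jy; apply/integral_eltP; rewrite rpredM //.
    exact: (ideal_int iI Ix).
  exact: (ideal_int iJ Jy).
- by exists 0%N, (fun=> 0), (fun=> 0); split=> [[]|[]|] //; rewrite big_ord0.
- exact: ideal_mul_add.
move=> r x /integral_eltP Ar [n [u [v [Iu Jv ->]]]].
exists n, (fun i => r * u i), v; split=> // [i|]; first exact: ideal_mull.
by rewrite mulr_sumr; apply: eq_bigr => i _; rewrite mulrA.
Qed.

Lemma ideal_dvd_sub I J : ideal_dvd I J -> is_ideal I -> J `<=` I.
Proof.
move=> [H iH ->] iI; apply: ideal_mul_sub; first by case: iI.
  by move=> x y; apply: ideal_add.
move=> x y Ix Hy; apply: ideal_mulr => //; exact: (ideal_int iH).
Qed.

Lemma prime_ideal_prod (Q : set F) n (f : 'I_n -> F) : prime_ideal Q ->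
  (forall i, f i \in A) -> Q (\prod_i f i) -> exists i, Q (f i).
Proof.
move=> pQ; elim: n f => [|n IHn] f Af.
  by rewrite big_ord0; case: pQ.
rewrite big_ord_recl => /(prime_ideal_mul pQ)[//||Qf|/IHn[//|i Qi]].
- by apply: rpred_prod.
- by exists ord0.
- by exists (lift ord0 i).
Qed.

(** When Frobenius is trivial modulo [p], each element of [Q] is killed modulo
    [p] by an element outside [Q]; a product of such elements would bring a
    relation of [p] with [Q ^ 2] down into [Q] itself. *)
Lemma unramified (p q : nat) (Q : set F) : (1 < q)%N -> p%:R != 0 :> F ->
  (forall z, z \in A -> dvd_in A p%:R (z ^+ q - z)) ->
  prime_ideal Q -> Q p%:R -> ~ ideal_mul Q Q p%:R.
Proof.
move=> q_gt1 p0 frob pQ Qp [n [u [v [Qu Qv pE]]]].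
have [iQ Q1 _] := pQ.
pose g z : F := 1 - z ^+ q.-1.
have gz z : z \in A -> dvd_in A p%:R (g z * z).
  move=> Az; have := dvd_in_opp (frob z Az).
  by rewrite /g mulrBl mul1r -exprSr prednK ?opprB // ltnW.
have Au i : u i \in A by apply: ideal_int (Qu i).
have Av i : v i \in A by apply: ideal_int (Qv i).
have Ag z : z \in A -> g z \in A by move=> Az; rewrite rpredB ?rpred1 ?rpredX.
have Qg z : Q z -> ~ Q (g z).
  move=> Qz Qgz; apply: Q1; have Az := ideal_int iQ Qz.
  rewrite -(subrK (z ^+ q.-1) 1); apply: ideal_add => //.
  have -> : q.-1 = q.-2.+1 by lia.
  by rewrite exprS; apply: ideal_mulr => //; apply: rpredX.
pose s := (\prod_i g (u i)) * (\prod_i g (v i)).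
have As : s \in A.
  by rewrite rpredM //; apply: rpred_prod => i _; apply: Ag.
have killed (f : 'I_n -> F) i : (forall j, f j \in A) ->
    dvd_in A p%:R ((\prod_j g (f j)) * f i).
  move=> Af; rewrite (bigD1 i) //= mulrAC; apply: dvd_in_mulr; last exact: gz.
  by apply: rpred_prod => j _; apply: Ag.
have su i : dvd_in A p%:R (s * u i).
  rewrite mulrAC; apply: dvd_in_mulr; last exact: killed.
  by apply: rpred_prod => j _; apply: Ag.
have sv i : dvd_in A p%:R (s * v i).
  rewrite -mulrA; apply: dvd_in_mull; last exact: killed.
  by apply: rpred_prod => j _; apply: Ag.
have : dvd_in A (p%:R * p%:R) (s * s * p%:R).
  rewrite [X in dvd_in _ _ (_ * X)]pE mulr_sumr; apply: dvd_in_sum => i.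
  by rewrite mulrACA; apply: dvd_in_mul.
move=> [r Ar]; rewrite mulrA => /(mulIf p0) ss.
have : Q (s * s) by rewrite ss; apply: ideal_mull.
have Pn (f : 'I_n -> F) : (forall i, Q (f i)) -> ~ Q (\prod_i g (f i)).
  move=> Qf /(prime_ideal_prod pQ)[i|i]; first by apply: Ag; apply: ideal_int (Qf i).
  exact: Qg.
have Qs : ~ Q s.
  move=> /(prime_ideal_mul pQ)[||/Pn|/Pn] //; apply: rpred_prod => i _; exact: Ag.
by move=> /(prime_ideal_mul pQ)[].
Qed.

End IdealMul.

(** * Maximal annihilators and their inverses *)

Section Annihilators.

Variable K : fieldExtType rat.
Local Notation A := (integral_elt K).
Hypothesis fin_res : forall c, (0 < c)%N -> exists (T : finType) (phi : K -> T),
  {in A &, forall y y', phi y = phi y' -> dvd_in A c%:R (y - y')}.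

(** Two powers [c * b ^+ i] and [c * b ^+ j] agree modulo [c], so that [b] is
    a root of a monic trinomial. *)
Lemma almost_integral (b : K) c : (0 < c)%N ->
  (forall j, c%:R * b ^+ j \in A) -> b \in A.
Proof.
move=> c_gt0 Acb; have [T [phi phiP]] := fin_res c_gt0.
have [i [j [ij eij]]] : exists i j : nat,
    (i < j)%N /\ phi (c%:R * b ^+ i) = phi (c%:R * b ^+ j).
  pose h (i : 'I_#|T|.+1) := phi (c%:R * b ^+ i).
  have /injectivePn[i [j nij hij]] : ~~ injectiveb h.
    by apply/negP => /injectiveP/leq_card; rewrite card_ord ltnn.
  by case: (ltngtP i j) => [lt|lt|/val_inj/eqP]; [exists i, j|exists j, i|rewrite (negPf nij)].
have [r Ar] := phiP _ _ (Acb j) (Acb i) (esym eij).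
rewrite -mulrBr mulrC => /(mulIf (natr_field_neq0 K c_gt0)) rE.
apply: (@integral_elt_root _ ('X^j - ('X^i + r%:P))).
- by rewrite monicE lead_coefDl ?lead_coefXn // size_polyN size_polyXn ltnS
    (leq_trans (size_polyD _ _)) // geq_max size_polyXn ij (leq_trans (size_polyC_leq1 _)) //
    (leq_trans _ ij).
- by rewrite rpredB ?rpredD ?rpredX ?polyOverX ?polyOverC.
- by rewrite rootE !hornerE opprD addrA rE subrr.
Qed.

(** Among the multiples [y] of [v] outside [(x)], take one for which the ideal
    generated by [y] and [x] meets the fewest residue classes: multiplying [y] by
    [s] then either falls into [(x)] or leaves this ideal unchanged. *)
Lemma maximal_annihilator (x v : K) : x \in A -> x != 0 -> v \in A ->
  ~ dvd_in A x v ->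
  exists2 r, r \in A & ~ dvd_in A x (r * v) /\
    forall s, s \in A -> dvd_in A x (s * (r * v)) \/
      exists2 u, u \in A & dvd_in A x (r * v - u * s * (r * v)).
Proof.
move=> Ax x0 Av xv; have [c c_gt0 xc] := integral_dvd_nat Ax x0.
have [T [phi phiP]] := fin_res c_gt0.
pose S (y : K) : {set T} := finset (fun t => `[< exists2 z, z \in A /\ phi z = t &
  exists2 u, u \in A & dvd_in A x (z - u * y) >]).
have inS y t : reflect (exists2 z, z \in A /\ phi z = t &
  exists2 u, u \in A & dvd_in A x (z - u * y)) (t \in S y).
  by rewrite finset.inE; apply: asboolP.
pose P n := `[< exists2 r, r \in A & ~ dvd_in A x (r * v) /\ #|S (r * v)| = n >].
have exP : exists n, P n.
  by exists #|S (1 * v)|; apply/asboolP; exists 1; rewrite ?rpred1 ?mul1r.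
case: (ex_minnP exP) => n /asboolP[r Ar [xrv Sn]] nmin.
exists r => //; split=> // s As.
have [|xs] := pselect (dvd_in A x (s * (r * v))); [by left|right].
have sub : S (s * (r * v)) \subset S (r * v).
  apply/fintype.subsetP => t /inS[z Az [u Au xz]]; apply/inS; exists z => //.
  by exists (u * s); rewrite ?rpredM // -mulrA.
have /eqP eqS : S (s * (r * v)) == S (r * v).
  rewrite eqEcard sub Sn; apply: nmin; apply/asboolP; exists (s * r).
    exact: rpredM.
  by rewrite -mulrA.
have : phi (r * v) \in S (r * v).
  apply/inS; exists (r * v); first by rewrite rpredM.
  by exists 1; rewrite ?rpred1 // mul1r subrr; apply: dvd_in0.
rewrite -eqS => /inS[z [Az /esym eqz] [u Au xz]].
exists u => //; have /(dvd_in_trans xc) := phiP _ _ (rpredM Ar Av) Az eqz.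
by move=> /dvd_in_add/(_ xz); rewrite addrA subrK mulrA.
Qed.

(** The ideal [Q] of the multipliers of [r * v] into [(x)] is maximal, and
    [b = r * v / x] does not map [Q] into itself since [b] is not integral;
    hence [1] lies in [Q + b * Q], which makes [A + b * A] the inverse of [Q].
    If moreover [x] divides [v ^+ 2], then [x * (A + b * A) ^ 2] is an ideal of
    [A], so [Q ^ 2] divides [(x)]. *)
Lemma squareful_principal (x v : K) : x \in A -> x != 0 -> v \in A ->
  ~ dvd_in A x v -> dvd_in A x (v ^+ 2) ->
  exists Q : set K, [/\ prime_ideal Q,
    ideal_dvd (ideal_mul Q Q) (principal x) &
    forall y, y \in A -> dvd_in A x (y * v) -> Q y].
Proof.
move=> Ax x0 Av xv xvv.
have [r Ar [xrv rmax]] := maximal_annihilator Ax x0 Av xv.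
pose V := r * v; have AV : V \in A by rewrite rpredM.
have xVV : dvd_in A x (V ^+ 2) by rewrite exprMn; apply: dvd_in_mull; rewrite ?rpredX.
pose Q : set K := [set q | q \in A /\ dvd_in A x (q * V)].
have iQ : is_ideal Q.
  split.
  - by move=> q [/integral_eltP].
  - by split; rewrite ?rpred0 // mul0r; apply: dvd_in0.
  - move=> p q [Ap xp] [Aq xq]; split; first exact: rpredD.
    by rewrite mulrDl; apply: dvd_in_add.
  - move=> s q /integral_eltP As [Aq xq]; split; first exact: rpredM.
    by rewrite -mulrA; apply: dvd_in_mull.
have pQ : prime_ideal Q.
  split=> // [[_]|p q /integral_eltP Ap /integral_eltP Aq [_ xpq]].
    by rewrite mul1r.
  have [xp|[u Au xu]] := rmax _ Ap; [by left|right; split=> //].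
  have := dvd_in_add (dvd_in_mull Aq xu) (dvd_in_mull Au xpq).
  by congr dvd_in; rewrite /V; ring.
pose b := V / x; have bx : b * x = V by rewrite divfK.
have bQ q : Q q -> b * q \in A.
  move=> [Aq [s As sE]]; suff -> : b * q = s by [].
  by apply: (mulIf x0); rewrite -sE mulrAC bx mulrC.
have [q1 [q2 [Qq1 Qq2 q12]]] : exists q1 q2, [/\ Q q1, Q q2 & 1 = q1 + b * q2].
  have [bQQ|] := pselect (forall q, Q q -> Q (b * q)).
    case: xrv; exists b; last by rewrite bx.
    have [c c_gt0 [e Ae cE]] := integral_dvd_nat Ax x0.
    apply: (almost_integral c_gt0) => j.
    have Qx : Q x by split=> //; rewrite mulrC; apply: dvd_in_mull => //; apply: dvd_in_refl.
    have : Q (b ^+ j * x).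
      by elim: j => [|j IHj]; rewrite ?mul1r // exprS -mulrA; apply: bQQ.
    by move=> [AQ _]; rewrite cE mulrAC -mulrA rpredM.
  move=> /existsNP[q /not_implyP[Qq nQ]]; have Abq := bQ _ Qq.
  have [xbq|[u Au xu]] := rmax _ Abq; first by case: nQ.
  exists (1 - u * (b * q)), (u * q); split; last by ring.
    split; first by apply: rpredB; [exact: rpred1|exact: rpredM].
    by rewrite mulrBl mul1r.
  exact: ideal_mull.
have AVVx : V ^+ 2 / x \in A by case: xVV => s As ->; rewrite mulfK.
pose H : set K := [set h | exists h0 h1 h2, [/\ h0 \in A, h1 \in A, h2 \in A &
  h = h0 * x + h1 * V + h2 * (V ^+ 2 / x)]].
have iH : is_ideal H.
  split.
  - move=> _ [h0 [h1 [h2 [A0 A1 A2 ->]]]]; apply/integral_eltP.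
    by rpred_closed.
  - by exists 0, 0, 0; rewrite !rpred0 !mul0r !addr0.
  - move=> _ _ [g0 [g1 [g2 [B0 B1 B2 ->]]]] [h0 [h1 [h2 [A0 A1 A2 ->]]]].
    by exists (g0 + h0), (g1 + h1), (g2 + h2); split; rpred_closed; ring.
  - move=> s _ /integral_eltP As [h0 [h1 [h2 [A0 A1 A2 ->]]]].
    by exists (s * h0), (s * h1), (s * h2); split; rpred_closed; ring.
exists Q; split=> //; last first.
  move=> y Ay xyv; split=> //; rewrite /V mulrCA; exact: dvd_in_mull.
exists H => //; apply/seteqP; split=> [y /principalE[s As ->]|].
  have -> : s * x = (q1 * q1) * (s * x) + (q1 * q2) * (2 * s * V)
      + (q2 * q2) * (s * (V ^+ 2 / x)).
    transitivity (s * x * (q1 + b * q2) ^+ 2); first by rewrite -q12 expr1n mulr1.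
    by rewrite /b; field.
  have QQ p q : Q p -> Q q -> ideal_mul Q Q (p * q) by apply: ideal_mul_mem.
  do 2?apply: ideal_mul_add; apply: ideal_mul_mem; try exact: QQ.
  - by exists s, 0, 0; split; rpred_closed; rewrite !mul0r !addr0.
  - by exists 0, (2 * s), 0; split; rpred_closed; rewrite !mul0r addr0 add0r.
  - by exists 0, 0, s; split; rpred_closed; rewrite !mul0r !add0r.
apply: (ideal_mul_sub (P := principal x)).
- by apply/principalE; apply: dvd_in0.
- by move=> y z /principalE xy /principalE xz; apply/principalE; apply: dvd_in_add.
move=> y h QQy [h0 [h1 [h2 [A0 A1 A2 ->]]]]; move: y QQy.
apply: (ideal_mul_sub (P := fun y => principal x (y * _))).
- by rewrite mul0r; apply/principalE; apply: dvd_in0.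
- move=> y z /principalE xy /principalE xz; apply/principalE.
  by rewrite mulrDl; apply: dvd_in_add.
move=> p q [Ap xp] [Aq xq]; apply/principalE.
have [s As sE] := xp; have [t At tE] := xq.
exists (p * q * h0 + h1 * (p * t) + h2 * (s * t)); first by rpred_closed.
rewrite !mulrDr !mulrDl; congr (_ + _ + _); first by ring.
  by rewrite -!mulrA -tE; ring.
have -> : V ^+ 2 / x = V * V / x by ring.
apply: (mulIf x0); rewrite !mulrA divfK //.
have -> : h2 * s * t * x * x = h2 * (s * x) * (t * x) by ring.
by rewrite -sE -tE /V; ring.
Qed.

Lemma squarefree_principal_neq0 (x : K) : squarefree_ideal (principal x) -> x != 0.
Proof.
move=> [x0 _]; apply/eqP => xE; apply: x0; rewrite xE.
apply/seteqP; split=> [y [r _ <-]|_ ->]; first by rewrite mulr0.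
by apply/principalE; apply: dvd_in0.
Qed.

Lemma squarefree_reduced (x w : K) : x \in A -> squarefree_ideal (principal x) ->
  w \in A -> dvd_in A x (w ^+ 2) -> dvd_in A x w.
Proof.
move=> Ax sx Aw xww; have x0 := squarefree_principal_neq0 sx.
apply: contrapT => xw.
have [Q [pQ QQx _]] := squareful_principal Ax x0 Aw xw xww.
by case: sx => _ /(_ Q pQ).
Qed.

Lemma prime_lies_above2 (Q : set K) : prime_ideal Q -> Q 2%:R -> lies_above Q 2.
Proof.
move=> [iQ Q1 _] Q2.
have evenQ (c : int) : Q (c * 2)%:~R.
  by rewrite rmorphM; apply: ideal_mull; rewrite ?rpred_int.
apply/seteqP; split=> c /=; last by move=> /dvdzP[e ->].
move=> Qc; apply/dvdzP; exists (c %/ 2)%Z.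
have := divz_eq c 2; have := modz_ge0 c (isT : 2 != 0 :> int).
have := ltz_pmod c (isT : 0 < 2 :> int).
case: (modz c 2) => // [[|[|//]]] _ _ e; first by rewrite {1}e addr0.
case: Q1; have -> : 1 = c%:~R - ((c %/ 2)%Z * 2)%:~R :> K.
  by rewrite {1}e rmorphD /= addrAC subrr add0r.
exact: ideal_sub.
Qed.

(** If [u] is not invertible modulo [2], then [v = u * (1 - u ^+ q.-1)] is
    divisible by [2] but not by [2 * u], although [v ^+ 2] is. *)
Lemma unit_mod2 (q : nat) (u : K) : (1 < q)%N ->
  (forall z, z \in A -> dvd_in A 2 (z ^+ q - z)) -> u \in A ->
  (forall P : set K, prime_ideal P -> lies_above P 2 ->
     ~ ideal_dvd (ideal_mul P P) (principal (2 * u))) ->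
  exists2 u', u' \in A & dvd_in A 2 (u * u' - 1).
Proof.
move=> q_gt1 frob Au uP.
have A2 : 2 \in A by exact: (rpred_nat _ 2).
have n20 : 2 != 0 :> K := natr_field_neq0 K (isT : (0 < 2)%N).
have [u0|u0] := eqVneq u 0.
  (* The zero ideal is a multiple of every square, so any prime above [2] will
     do; [4] and [v = 2] provide one. *)
  have n21 : ~ dvd_in A 2 (1 : K) by move=> /(@dvd_in_int K 2 1 isT).
  have [] := @squareful_principal (2 * 2) 2 _ _ A2.
  - by rpred_closed.
  - by rewrite mulf_neq0.
  - by move=> [h Ah]; rewrite -{1}[2]mul1r mulrA => /(mulIf n20) e; apply: n21; exists h.
  - by rewrite expr2; apply: dvd_in_refl.
  move=> Q [pQ _ Q2]; have {}Q2 := Q2 2 A2 (dvd_in_refl _ _).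
  case: (uP Q pQ (prime_lies_above2 pQ Q2)); exists [set 0].
    split=> // [_ ->|_ _ -> ->|r _ _ ->]; rewrite ?addr0 ?mulr0 //.
    by apply/integral_eltP; rewrite rpred0.
  apply/seteqP; split=> y; rewrite u0 mulr0.
    move=> [r _ <-]; have -> : r * 0 = (2 * 2) * 0 by rewrite !mulr0.
    apply: ideal_mul_mem => //.
    exact: ideal_mul_mem.
  have P0 : principal (0 : K) 0 by apply/principalE; apply: dvd_in0.
  move: y; apply: (ideal_mul_sub (P := principal 0)) => // [a b [r _ <-] [s _ <-]|a b _ ->].
    by rewrite !mulr0 addr0.
  by rewrite mulr0.
pose e := 1 - u ^+ q.-1; have Ae : e \in A by rpred_closed.
have [[r Ar eE]|e2] := pselect (dvd_in A 2 e).
  exists (u ^+ q.-2); first exact: rpredX.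
  exists (- r); first by rewrite rpredN.
  rewrite -exprS; have -> : q.-2.+1 = q.-1 by lia.
  by rewrite mulNr -eE /e opprB.
have [r Ar ueE] : dvd_in A 2 (u * e).
  have := dvd_in_opp (frob u Au); congr dvd_in.
  by rewrite /e mulrBr mulr1 -exprS prednK ?opprB // ltnW.
have A2u : 2 * u \in A by rpred_closed.
have [||||Q [pQ QQ Q2]] := @squareful_principal (2 * u) (u * e) A2u.
- by rewrite mulf_neq0.
- by rpred_closed.
- move=> [h Ah]; rewrite mulrC mulrA => /(mulIf u0) h2; apply: e2.
  by exists h.
- exists (r * e); first by rpred_closed.
  by rewrite expr2 {1}ueE; ring.
case: (uP Q pQ _ QQ); apply: prime_lies_above2 => //; apply: Q2 => //.
by rewrite mulrA; apply: dvd_in_mulr => //; apply: dvd_in_refl.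
Qed.

End Annihilators.

(** * Reduced quotients and integral closure *)

(** The quotient ring of [B] by [x] is reduced. *)
Definition reduced_mod (F : fieldType) (B : {pred F}) (x : F) : Prop :=
  forall w, w \in B -> dvd_in B x (w ^+ 2) -> dvd_in B x w.

Section Reduced.

Variables (F : fieldType) (B : subringClosed F).
Local Notation A := (integral_elt F).

Lemma reduced_modN x : reduced_mod B x -> reduced_mod B (- x).
Proof.
have dN y : dvd_in B (- x) y <-> dvd_in B x y.
  by split=> [] [q Bq ->]; exists (- q); rewrite ?rpredN // ?mulrNN // mulNr mulrN.
by move=> xr w Bw /dN /xr xw; apply/dN/xw.
Qed.

Lemma reduced_mod_pow x w r : reduced_mod B x -> w \in B ->
  dvd_in B x (w ^+ r) -> dvd_in B x w.
Proof.
move=> xr Bw xwr.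
have: dvd_in B x (w ^+ (2 ^ r)).
  have /ltnW lr : (r < 2 ^ r)%N by rewrite ltn_expl.
  by rewrite -(subnK lr) exprD; apply: dvd_in_mull => //; apply: rpredX.
elim: r {xwr} => [|r IHr]; first by rewrite expr1.
by rewrite expnSr exprM => /xr xw; apply/IHr/xw; apply: rpredX.
Qed.

(** Multiply a monic equation of [z] by a power of [s]. *)
Lemma integral_pow_dvd s z : s \in B -> s * z \in B -> z \in A ->
  exists r, dvd_in B s ((s * z) ^+ r).
Proof.
move=> Bs Bsz /integral_eltP[p mp pz].
have [r szp] : exists r, size p = r.+1.
  by exists (size p).-1; rewrite prednK // lt0n size_poly_eq0 monic_neq0.
exists r; have : (s * z) ^+ r = - \sum_(i < r) (s * z) ^+ i * s ^+ (r - i) * (p`_i)%:~R.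
  apply/eqP; rewrite -addr_eq0; apply/eqP; move/rootP: pz.
  rewrite (@horner_coef_wide _ r.+1) -?szp ?size_poly // szp big_ord_recr /= coef_map /=.
  have -> : p`_r = 1 by move/monicP: mp; rewrite lead_coefE szp.
  rewrite mul1r => pz0; rewrite -[RHS](mulr0 (s ^+ r)) -[in RHS]pz0 mulrDr mulr_sumr.
  rewrite addrC exprMn; congr (_ + _); apply: eq_bigr => i _.
  have -> : s ^+ r = s ^+ (r - i) * s ^+ i by rewrite -exprD subnK // ltnW.
  by rewrite coef_map /= exprMn; ring.
move=> ->; apply/dvd_in_opp/dvd_in_sum => i.
have -> : (r - i)%N = (r - i).-1.+1 by rewrite prednK // subn_gt0.
rewrite exprS mulrA mulrAC; apply: dvd_in_mulr; first by rpred_closed.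
by rewrite mulrAC; apply: dvd_in_mull; [rpred_closed|apply: dvd_in_refl].
Qed.

(** Division by [s] of an element of [B] stays in [B] if it is integral, since it
    makes the element nilpotent modulo [s]. *)
Lemma reduced_mod_integral s z : reduced_mod B s -> s != 0 -> s \in B ->
  s * z \in B -> z \in A -> z \in B.
Proof.
move=> sr s0 Bs Bsz Az; have [r /(reduced_mod_pow sr Bsz)[q Bq]] := integral_pow_dvd Bs Bsz Az.
by rewrite mulrC => /(mulIf s0) ->.
Qed.

End Reduced.

(** * Quadratic steps *)

Section QuadraticStep.

Variables (K0 : fieldType) (L : fieldExtType K0).
Local Notation A := (integral_elt L).
Implicit Types (F : {subfield L}) (B : subringClosed L).

(** [B] is an order of the subfield [F], integrally closed away from [2]. *)
Definition normal_away_from2 F B : Prop :=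
  [/\ {subset B <= F}, {subset B <= A} &
      forall z, z \in F -> z \in A -> exists N, 2 ^+ N * z \in B].

Definition adjoin_sqrt B (s : L) : {pred L} :=
  fun z => `[< exists x y, [/\ x \in B, y \in B & z = x + y * s] >].

Lemma adjoin_sqrtP B s z :
  reflect (exists x y, [/\ x \in B, y \in B & z = x + y * s]) (z \in adjoin_sqrt B s).
Proof. exact: asboolP. Qed.

Lemma adjoin_sqrt_subring B s : s ^+ 2 \in B -> subring_closed (adjoin_sqrt B s).
Proof.
move=> Bss; split.
- by apply/adjoin_sqrtP; exists 1, 0; split; rpred_closed; rewrite mul0r addr0.
- move=> _ _ /adjoin_sqrtP[x [y [Bx By ->]]] /adjoin_sqrtP[u [v [Bu Bv ->]]].
  by apply/adjoin_sqrtP; exists (x - u), (y - v); split; rpred_closed; ring.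
- move=> _ _ /adjoin_sqrtP[x [y [Bx By ->]]] /adjoin_sqrtP[u [v [Bu Bv ->]]].
  apply/adjoin_sqrtP; exists (x * u + y * v * s ^+ 2), (x * v + y * u).
  by split; rpred_closed; ring.
Qed.

Lemma Fadjoin_sqrtP F s z : s ^+ 2 \in F -> z \in <<F; s>>%VS ->
  exists x y, [/\ x \in F, y \in F & z = x + y * s].
Proof.
move=> Fss /Fadjoin_polyP[p Fp ->]; pose X := 'X^2 - (s ^+ 2)%:P.
have FX : X \is a polyOver F by rewrite rpredB ?rpredX ?polyOverX ?polyOverC.
have sX : size X = 3%N by rewrite size_XnsubC.
have X0 : X != 0 by rewrite -size_poly_eq0 sX.
have Fq : p %% X \is a polyOver F by rewrite modp_polyOver.
have sq : (size (p %% X)%R <= 2)%N by rewrite -ltnS -sX ltn_modp.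
exists (p %% X)`_0, (p %% X)`_1; split; try exact: (polyOverP Fq).
rewrite {1}(divp_eq p X) hornerD hornerM !hornerE subrr mulr0 add0r.
by rewrite (horner_coef_wide _ sq) !big_ord_recl big_ord0 /= addr0 mulr1 expr1.
Qed.

Lemma sqrt_unique F s x y : s \notin F -> x \in F -> y \in F ->
  x + y * s = 0 -> x = 0 /\ y = 0.
Proof.
move=> Fs Fx Fy /eqP xys; have y0 : y = 0.
  apply/eqP/negPn/negP => y0; case/negP: Fs.
  have -> : s = - x / y.
    by apply: (mulIf y0); rewrite divfK // mulrC; apply/eqP; rewrite -addr_eq0 addrC.
  by rewrite rpred_div ?rpredN.
by move: xys; rewrite y0 mul0r addr0 => /eqP.
Qed.

(** An integer polynomial takes conjugate values at conjugate points. *)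
Lemma integral_conj F s x y : s \notin F -> s ^+ 2 \in F -> x \in F -> y \in F ->
  x + y * s \in A -> x - y * s \in A.
Proof.
move=> Fs Fss Fx Fy /integral_eltP[p mp /rootP pz].
have [u [v [Fu Fv pu pv]]] : exists u v, [/\ u \in F, v \in F,
    (map_poly intr p).[x + y * s] = u + v * s &
    (map_poly intr p).[x - y * s] = u - v * s].
  elim/poly_ind: (p) => [|q c [u [v [Fu Fv pu pv]]]].
    by exists 0, 0; rewrite rpred0 rmorph0 !horner0 mul0r subr0 addr0.
  have [e Fe eE] : exists2 e, e \in F & e = s ^+ 2 by exists (s ^+ 2).
  exists (u * x + v * y * e + c%:~R), (u * y + v * x).
  rewrite !rmorphD !rmorphM /= map_polyX map_polyC /= !hornerE pu pv.
  by split; rpred_closed; rewrite eE; ring.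
move: pu; rewrite pz => /esym/(sqrt_unique Fs Fu Fv)[u0 v0].
by apply: (integral_eltE mp); apply/rootP; rewrite pv u0 v0 mul0r subr0.
Qed.

(** If [B / (s ^+ 2)] is reduced, then so is [B' / (s)] for [B' = B + B * s], to
    which it is isomorphic.  For [z] integral in [F(s)], the trace shows that
    [s * z] is in [B'] up to a power of [2], and reducedness cancels [s]. *)
Lemma quadratic_step F B s : normal_away_from2 F B -> s ^+ 2 \in B -> s \notin F ->
  reduced_mod B (s ^+ 2) ->
  exists B' : subringClosed L, [/\ normal_away_from2 <<F; s>>%AS B',
    {subset B <= B'}, s \in B',
    (forall z, z \in B' -> exists x y, [/\ x \in B, y \in B & z = x + y * s]) &
    (forall e, e \in B -> reduced_mod B (e ^+ 2 - s ^+ 2) ->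
       reduced_mod B' (s - e))].
Proof.
move=> [BF BA Bnorm] Bss Fs ssred.
have [B' B'P] : {B' : subringClosed L & forall z,
    reflect (exists x y, [/\ x \in B, y \in B & z = x + y * s]) (z \in B')}.
  pose subr := GRing.isSubringClosed.Build L (adjoin_sqrt B s) (adjoin_sqrt_subring Bss).
  pose B' : subringClosed L := HB.pack (adjoin_sqrt B s) subr.
  by exists B' => z; apply: adjoin_sqrtP.
have BB' : {subset B <= B'}.
  by move=> x Bx; apply/B'P; exists x, 0; split; rpred_closed; rewrite mul0r addr0.
have B's : s \in B' by apply/B'P; exists 0, 1; split; rpred_closed; rewrite mul1r add0r.
have As : s \in A.
  apply: (@integral_elt_root _ ('X^2 - (s ^+ 2)%:P)); first exact: monicXnsubC.
    by rewrite rpredB ?rpredX ?polyOverX ?polyOverC ?BA.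
  by rewrite rootE !hornerE subrr.
have s0 : s != 0 by apply: contraNneq Fs => ->; rewrite rpred0.
have Fss := BF _ Bss.
(* Modulo [s - e], an element [x + y * s] of [B'] becomes [x + y * e]. *)
have red e : e \in B -> reduced_mod B (e ^+ 2 - s ^+ 2) -> reduced_mod B' (s - e).
  move=> Be ered _ /B'P[x [y [Bx By ->]]] [_ /B'P[p [q [Bp Bq ->]]] wE].
  have -> : x + y * s = (x + y * e) + y * (s - e) by ring.
  apply: dvd_in_add; last first.
    by apply: dvd_in_mull; [exact: BB'|exact: dvd_in_refl].
  have Bw : x + y * e \in B by rpred_closed.
  have [p' [q' [Bp' Bq' wE']]] : exists p' q', [/\ p' \in B, q' \in B &
      (x + y * e) ^+ 2 = (p' + q' * s) * (s - e)].
    exists (p - 2 * y * (x + y * e) + y ^+ 2 * e), (q - y ^+ 2).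
    split; rpred_closed; try exact: (rpred_nat _ 2).
    have -> : (x + y * e) ^+ 2 = (x + y * s) ^+ 2 - 2 * (x + y * e) * y * (s - e)
        - y ^+ 2 * (s - e) ^+ 2 by ring.
    by rewrite wE; ring.
  have [|||e1 /eqP] := @sqrt_unique F s ((x + y * e) ^+ 2 - q' * s ^+ 2 + p' * e)
      (q' * e - p') Fs.
  - by apply: BF; rpred_closed.
  - by apply: BF; rpred_closed.
  - by rewrite wE'; ring.
  rewrite subr_eq0 => /eqP p'E.
  have [|r Br ->] := ered _ Bw.
    exists (- q'); first by rewrite rpredN.
    have -> : (x + y * e) ^+ 2 = ((x + y * e) ^+ 2 - q' * s ^+ 2 + p' * e)
      + q' * s ^+ 2 - p' * e by ring.
    by rewrite e1 -p'E; ring.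
  exists (- r * (s + e)); last by ring.
  by have := (BB' _ Br, BB' _ Be) => -[B'r B'e]; rpred_closed.
have red0 : reduced_mod B' s.
  have := red 0 (rpred0 _); rewrite expr0n /= sub0r subr0 => h.
  exact/h/reduced_modN.
exists B'; split=> // [|z /B'P //]; split.
- move=> _ /B'P[x [y [Bx By ->]]].
  have sub u : u \in B -> u \in <<F; s>>%VS.
    by move=> /BF Fu; apply: (subvP (subv_adjoin F s)).
  by rewrite rpredD ?rpredM ?memv_adjoin //; apply: sub.
- move=> _ /B'P[x [y [Bx By ->]]].
  by have := (BA _ Bx, BA _ By) => -[Ax Ay]; rpred_closed.
move=> z /(Fadjoin_sqrtP Fss)[x [y [Fx Fy ->]]] Az.
have Az' := integral_conj Fs Fss Fx Fy Az.
(* The trace of [z = x + y * s], and that of [s * z], lie in [B] up to a power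
   of [2]. *)
have [||N1 BN1] := Bnorm (2 * x).
- by rewrite rpredM ?(rpred_nat _ 2).
- have -> : 2 * x = (x + y * s) + (x - y * s) by ring.
  by rpred_closed.
have [||N2 BN2] := Bnorm (2 * y * s ^+ 2).
- by apply: rpredM Fss; rewrite rpredM ?(rpred_nat _ 2).
- have -> : 2 * y * s ^+ 2 = ((x + y * s) - (x - y * s)) * s by ring.
  by rpred_closed.
have B2 : 2 \in B by exact: (rpred_nat _ 2).
exists (N1 + N2).+1; apply: (reduced_mod_integral red0 s0 B's); last first.
  by rpred_closed; exact: (rpred_nat _ 2).
have -> : s * (2 ^+ (N1 + N2).+1 * (x + y * s)) =
    2 ^+ N1 * (2 ^+ N2 * (2 * y * s ^+ 2)) + 2 ^+ N2 * (2 ^+ N1 * (2 * x)) * s.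
  by rewrite exprS exprD; ring.
by apply/B'P; do 2?eexists; split; last reflexivity; rpred_closed.
Qed.

End QuadraticStep.

Lemma dvd_in_rmorph (K : fieldExtType rat) (E : fieldType) (phi : {rmorphism K -> E})
    (c : nat) (x : K) (q : E) :
  (0 < c)%N -> q \in integral_elt E -> phi x = q * c%:R ->
  dvd_in (integral_elt K) c%:R x.
Proof.
move=> c_gt0 Aq xE; have c0 := natr_field_neq0 K c_gt0.
have c0' : c%:R != 0 :> E by rewrite -(rmorph_nat phi c) fmorph_eq0.
exists (x / c%:R); last by rewrite divfK.
have qE : phi (x / c%:R) = q.
  by apply: (mulIf c0'); rewrite -xE -(rmorph_nat phi c) -rmorphM divfK.
by move: Aq; rewrite -qE integral_elt_rmorph.
Qed.

(** * The tower of quadratic extensions below a root of an iterate *)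

Section Tower.

Variables (K : fieldExtType rat) (L : fieldExtType K) (alpha : L).
Hypothesis alpha_gen : <<1; alpha>>%VS = fullv.
Local Notation A := (integral_elt K).
Local Notation iota := (in_alg L).
Local Notation lift p := (map_poly (in_alg L) p).

(** The order [A[alpha]]. *)
Definition order_gen : {pred L} := fun z =>
  `[< exists2 q : {poly K}, q \is a polyOver A & z = (lift q).[alpha] >].

Lemma order_genP z : reflect
  (exists2 q : {poly K}, q \is a polyOver A & z = (lift q).[alpha]) (z \in order_gen).
Proof. exact: asboolP. Qed.

Fact order_gen_subring : subring_closed order_gen.
Proof.
split.
- by apply/order_genP; exists 1; rewrite ?rpred1 // rmorph1 hornerE.
- move=> _ _ /order_genP[p Ap ->] /order_genP[q Aq ->]; apply/order_genP.
  by exists (p - q); rewrite ?rpredB // rmorphB !hornerE.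
- move=> _ _ /order_genP[p Ap ->] /order_genP[q Aq ->]; apply/order_genP.
  by exists (p * q); rewrite ?rpredM // rmorphM !hornerE.
Qed.

HB.instance Definition _ :=
  GRing.isSubringClosed.Build L order_gen order_gen_subring.

Lemma order_gen_const x : x \in A -> iota x \in order_gen.
Proof.
by move=> Ax; apply/order_genP; exists x%:P; rewrite ?polyOverC // map_polyC hornerC.
Qed.

Lemma order_gen_horner p : p \is a polyOver A -> (lift p).[alpha] \in order_gen.
Proof. by move=> Ap; apply/order_genP; exists p. Qed.

Fact image_subring : subring_closed
  ((fun z => `[< exists2 x, x \in A & z = iota x >]) : {pred L}).
Proof.
split.
- by apply/asboolP; exists 1; rewrite ?rpred1 ?rmorph1.
- move=> _ _ /asboolP[x Ax ->] /asboolP[y Ay ->]; apply/asboolP.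
  by exists (x - y); rewrite ?rpredB ?rmorphB.
- move=> _ _ /asboolP[x Ax ->] /asboolP[y Ay ->]; apply/asboolP.
  by exists (x * y); rewrite ?rpredM ?rmorphM.
Qed.

Lemma image_subringClosed : {B : subringClosed L &
  forall z, z \in B <-> exists2 x, x \in A & z = iota x}.
Proof.
pose subr := GRing.isSubringClosed.Build L _ image_subring.
pose B : subringClosed L := HB.pack ((fun z => `[< exists2 x, x \in A & z = iota x >]) : {pred L}) subr.
by exists B => z; split=> /asboolP.
Qed.

(** The generator is a root of [h - h(alpha)], a polynomial of degree [e] over [F].
    This bound makes every step of the tower a genuine quadratic extension. *)
Lemma dim_le_value (F : {subfield L}) (h : {poly K}) e : size h = e.+1 -> (0 < e)%N ->
  (lift h).[alpha] \in F -> (\dim {:L} <= e * \dim F)%N.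
Proof.
move=> sh e_gt0 Fh; pose p := lift h - ((lift h).[alpha])%:P.
have Fp : p \is a polyOver F.
  by rewrite rpredB ?polyOverC ?alg_polyOver.
have sp : size p = e.+1.
  rewrite size_polyDl size_map_poly ?sh // size_polyN.
  by rewrite (leq_ltn_trans (size_polyC_leq1 _)).
have p0 : p != 0 by rewrite -size_poly_eq0 sp.
have : minPoly F alpha %| p by apply: minPoly_dvdp => //; rewrite rootE !hornerE subrr.
move=> /(dvdp_leq p0); rewrite size_minPoly sp ltnS => le_e.
have -> : fullv = <<F; alpha>>%VS.
  apply/eqP; rewrite eqEsubv subvf andbT -alpha_gen.
  by apply/FadjoinP; rewrite sub1v memv_adjoin.
by rewrite dim_Fadjoin leq_mul2r le_e orbT.
Qed.

Lemma dim_Fadjoin_sqrt (F : {subfield L}) (s : L) : s ^+ 2 \in F ->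
  (\dim <<F; s>> <= 2 * \dim F)%N.
Proof.
move=> Fss; rewrite dim_Fadjoin leq_mul2r; apply/orP; right.
pose X := 'X^2 - (s ^+ 2)%:P.
have FX : X \is a polyOver F by rewrite rpredB ?rpredX ?polyOverX ?polyOverC.
have sX : size X = 3%N by rewrite size_XnsubC.
have X0 : X != 0 by rewrite -size_poly_eq0 sX.
have : minPoly F s %| X by apply: minPoly_dvdp => //; rewrite rootE !hornerE subrr.
by move=> /(dvdp_leq X0); rewrite size_minPoly sX ltnS.
Qed.

(** What the induction along the tower carries.  The next square root to be taken
    is that of [T] or of [T - E]; the point [E] runs through the images of the
    fixed point [- mu ^ 2] of [f], as [T] runs through those of [alpha]. *)
Definition stage (j : nat) (T E : L) : Prop :=
  exists (F : {subfield L}) (B : subringClosed L),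
    [/\ normal_away_from2 F B /\ (\dim F <= 2 ^ j)%N,
        forall x, x \in A -> iota x \in B,
        {subset B <= order_gen},
        T \in B /\ E \in B &
        reduced_mod B T /\ reduced_mod B (T - E)].

Lemma stage0 t e : t \in A -> reduced_mod A t -> reduced_mod A (t - e) ->
  e \in A -> stage 0 (iota t) (iota e).
Proof.
move=> At tr ter Ae; have [B BP] := image_subringClosed.
have B_iota x : x \in A -> iota x \in B by move=> Ax; apply/BP; exists x.
have red x : x \in A -> reduced_mod A x -> reduced_mod B (iota x).
  move=> Ax xr _ /BP[w Aw ->] [_ /BP[q Aq ->]].
  rewrite -rmorphXn -rmorphM => /fmorph_inj wE.
  have [|r Ar ->] := xr w Aw; first by exists q.
  by exists (iota r); rewrite ?rmorphM ?B_iota.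
exists 1%AS, B; split=> //; last 2 first.
- by split; apply: B_iota.
- by split; [exact: red|rewrite -rmorphB; apply: red; rewrite ?rpredB].
- split; last by rewrite dimv1.
  split=> [_ /BP[x Ax ->]|_ /BP[x Ax ->]|z].
  + by apply/vlineP; exists x.
  + by rewrite integral_elt_rmorph.
  + move=> /vlineP[x ->]; rewrite (integral_elt_rmorph iota) => Ax.
    by exists 0%N; rewrite mul1r; apply: B_iota.
- by move=> _ /BP[x Ax ->]; apply: order_gen_const.
Qed.

(** One square root [s], shifted by [e1].  The new quotients, by [s - e1] and by
    [s - e2], are isomorphic to quotients by [s ^+ 2 - e1 ^+ 2] and
    [s ^+ 2 - e2 ^+ 2], so that they are reduced as soon as these are old ones. *)
Lemma stage_step j T E (h : {poly K}) e (c e1 e2 : K) (s T' E' : L) :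
  stage j T E -> h \is a polyOver A -> size h = e.+1 -> (0 < e)%N ->
  (e * 2 ^ j < \dim {:L})%N -> c \in A -> e1 \in A -> e2 \in A ->
  s = (lift h).[alpha] + iota c -> T' = s - iota e1 -> E' = iota e2 - iota e1 ->
  s ^+ 2 = T \/ s ^+ 2 = T - E ->
  s ^+ 2 - iota e1 ^+ 2 = T \/ s ^+ 2 - iota e1 ^+ 2 = T - E ->
  s ^+ 2 - iota e2 ^+ 2 = T \/ s ^+ 2 - iota e2 ^+ 2 = T - E ->
  stage j.+1 T' E'.
Proof.
move=> [F [B [[normB dimF] B_iota Bsub [BT BE] [redT redTE]]]] Ah sh e_gt0 lt_dim Ac Ae1 Ae2 sE -> ->.
have red x : x = T \/ x = T - E -> reduced_mod B x by case=> ->.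
move=> s0 s1 s2; have Be1 := B_iota _ Ae1; have Be2 := B_iota _ Ae2.
have BTE : s ^+ 2 \in B.
  by case: s0 => ->; rpred_closed.
have Fs : s \notin F.
  apply/negP => Fs; move: lt_dim; rewrite ltnNge; apply/negP/negPn.
  have le_dim : (e * \dim F <= e * 2 ^ j)%N by rewrite leq_mul2l dimF orbT.
  apply: (leq_trans _ le_dim).
  apply: (dim_le_value sh e_gt0); rewrite -(addrK (iota c) (lift h).[alpha]) -sE.
  by apply: rpredB => //; case: normB => BF _ _; apply/BF/B_iota.
have [B' [normB' BB' B's B'E redB']] := quadratic_step normB BTE Fs (red _ s0).
exists <<F; s>>%AS, B'; split.
- split=> //; rewrite expnS; apply: leq_trans (dim_Fadjoin_sqrt _) _.
    by case: normB => BF _ _; apply: BF.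
  by rewrite leq_mul2l dimF.
- by move=> x Ax; apply/BB'/B_iota.
- move=> z /B'E[x [y [Bx By ->]]].
  have := (Bsub _ Bx, Bsub _ By, order_gen_horner Ah, order_gen_const Ac).
  by move=> [[[Gx Gy] Gh] Gc]; rewrite sE rpredD ?rpredM // rpredD.
- by have := (BB' _ Be1, BB' _ Be2) => -[Be1' Be2']; split; rpred_closed.
split.
  by apply: redB' => //; rewrite -opprB; apply/reduced_modN/red.
have -> : s - iota e1 - (iota e2 - iota e1) = s - iota e2 by ring.
by apply: redB' => //; rewrite -opprB; apply/reduced_modN/red.
Qed.

Lemma stage_final j E z : stage j alpha E -> z \in integral_elt L ->
  exists N, 2 ^+ N * z \in order_gen.
Proof.
move=> [F [B [[[BF _ normB] _] _ Bsub [BT _] _]]] Az.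
have [|N BN] := normB z _ Az; last by exists N; apply: Bsub.
have : (fullv <= F)%VS by rewrite -alpha_gen sub_adjoin1v; apply: BF.
by move=> /subvP; apply; rewrite memvf.
Qed.

End Tower.

(** * The prime 2 *)

(** Repeated squaring creates only even cross terms. *)
Lemma exprD_pow2 (F : fieldType) (B : subringClosed F) r x y : x \in B -> y \in B ->
  exists2 b, b \in B &
    (x + y) ^+ (2 ^ r) = x ^+ (2 ^ r) + y ^+ (2 ^ r) + 2 * x * y * b.
Proof.
move=> Bx By; elim: r => [|r [b Bb IHr]].
  by exists 0; [exact: rpred0|rewrite mulr0 addr0].
have [p pE] : exists p, (2 ^ r)%N = p.+1.
  by exists (2 ^ r).-1; rewrite prednK // expn_gt0.
rewrite expnSr !exprM IHr pE !exprS.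
exists (x ^+ p * y ^+ p + 2 * (x * x ^+ p + y * y ^+ p) * b + 2 * x * y * b ^+ 2).
  by have B2 := subring_nat B 2; rpred_closed.
by move: (x ^+ p) (y ^+ p) => X Y; ring.
Qed.

Section AtTwo.

Variables (K : fieldExtType rat) (L : fieldExtType K) (alpha : L).
Variables (mu a u u' : K) (k : nat).
Hypothesis k_gt0 : (0 < k)%N.
Local Notation A := (integral_elt K).
Local Notation iota := (in_alg L).
Local Notation lift p := (map_poly (in_alg L) p).
Local Notation d := (2 ^ k)%N.
Local Notation B := (order_gen alpha).
Let f : {poly K} := 'X^(2 * d) + (2 * mu) *: 'X^d.

Lemma horner_f (x : K) : f.[x] = x ^+ (2 * d) + 2 * mu * x ^+ d.
Proof. by rewrite /f !hornerE. Qed.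

Lemma horner_lift_f (x : L) :
  (lift f).[x] = x ^+ (2 * d) + 2 * iota mu * x ^+ d.
Proof.
rewrite /f rmorphD /= map_polyXn map_polyZ map_polyXn rmorphM.
by rewrite (rmorph_nat iota 2) !hornerE.
Qed.

Lemma poly_iterS n : poly_iter f n.+1 = f \Po poly_iter f n.
Proof. by []. Qed.

Lemma horner_poly_iterS n (x : K) :
  (poly_iter f n.+1).[x] = f.[(poly_iter f n).[x]].
Proof. by rewrite poly_iterS horner_comp. Qed.

Lemma horner_lift_poly_iterS n (x : L) :
  (lift (poly_iter f n.+1)).[x] = (lift f).[(lift (poly_iter f n)).[x]].
Proof. by rewrite poly_iterS map_comp_poly horner_comp. Qed.

Hypotheses (Amu : mu \in A) (Aa : a \in A) (Au : u \in A) (Au' : u' \in A).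
Hypothesis frob2 : forall z, z \in A -> dvd_in A 2 (z ^+ (2 * d) - z).
Hypothesis fa : f.[a] - a = 2 * u.
Hypothesis uu' : dvd_in A 2 (u * u' - 1).

Lemma reduced_mod2 : reduced_mod A 2.
Proof.
move=> w Aw ww; have := dvd_in_opp (frob2 Aw); rewrite opprB => h.
have := dvd_in_add h _; rewrite -[w in X in _ -> X](subrK (w ^+ (2 * d))); apply.
by rewrite exprM -(prednK (_ : 0 < d)%N) ?expn_gt0 // exprS; apply: dvd_in_mulr => //; rpred_closed.
Qed.

Lemma f_int x : x \in A -> f.[x] \in A.
Proof. by move=> Ax; rewrite horner_f; have A2 := subring_nat A 2; rpred_closed. Qed.

Lemma f_congr4 w : w \in A -> dvd_in A (2 * 2) (f.[a + 2 * w] - f.[a]).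
Proof.
move=> Aw; have A2 := subring_nat A 2.
have pow r : dvd_in A (2 * 2) ((a + 2 * w) ^+ (2 ^ r.+1) - a ^+ (2 ^ r.+1)).
  have [|b Ab ->] := exprD_pow2 r.+1 Aa (_ : 2 * w \in A); first by rpred_closed.
  have -> : (2 ^ r.+1)%N = ((2 ^ r.+1).-2 + 2)%N.
    by rewrite addn2; have := ltn_expl r.+1 (isT : (1 < 2)%N); lia.
  exists ((2 * w) ^+ ((2 ^ r.+1).-2) * w ^+ 2 + a * w * b); first by rpred_closed.
  rewrite !(exprD _ _ 2).
  by move: (a ^+ _) ((2 * w) ^+ _.-2) => X Y; ring.
have -> : f.[a + 2 * w] - f.[a] = ((a + 2 * w) ^+ (2 * d) - a ^+ (2 * d))
    + 2 * mu * ((a + 2 * w) ^+ d - a ^+ d) by rewrite !horner_f; ring.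
apply: dvd_in_add; first by rewrite -expnS.
apply: dvd_in_mull; first by rpred_closed.
by move: (pow k.-1); rewrite prednK.
Qed.

(** The derivative of [f] vanishes modulo [2] and [f] fixes [a] modulo [2], so
    all iterates agree with [f] at [a] modulo [4]. *)
Lemma iter_congr4 n : exists2 v, v \in A &
  (poly_iter f n.+1).[a] = a + 2 * u + 2 * 2 * v.
Proof.
elim: n => [|n [v Av IHn]].
  exists 0; first exact: rpred0.
  by rewrite horner_poly_iterS hornerX mulr0 addr0 -fa addrC subrK.
rewrite horner_poly_iterS IHn.
have A2 := subring_nat A 2.
have [|r Ar rE] := @f_congr4 (u + 2 * v); first by rpred_closed.
exists r => //; have fa' : f.[a] = a + 2 * u by rewrite -fa addrC subrK.
have -> : a + 2 * u + 2 * 2 * v = a + 2 * (u + 2 * v) by ring.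
by rewrite -[LHS](subrK f.[a]) rE fa'; ring.
Qed.

Local Notation t := (alpha - iota a).

Lemma order_gen_alpha : alpha \in B.
Proof.
by apply/order_genP; exists 'X; rewrite ?polyOverX // map_polyX hornerX.
Qed.

Lemma order_gen_t : t \in B.
Proof. by apply: subringB; [exact: order_gen_alpha|exact: order_gen_const]. Qed.

(** The polynomial [f] is [x ^+ (2 * d)] modulo [2], and powers of sums are
    controlled by [exprD_pow2]: only the leading and the constant coefficients of
    an iterate, as a polynomial in [t], may be odd. *)
Lemma iter_expansion n : exists2 b, b \in B &
  (lift (poly_iter f n)).[alpha] =
     t ^+ ((2 * d) ^ n) + 2 * t * b + iota (poly_iter f n).[a].
Proof.
have Bt := order_gen_t; have B2 := subring_nat B 2.
have Bmu := order_gen_const alpha Amu.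
elim: n => [|n [b Bb IHn]].
  exists 0; first exact: rpred0.
  by rewrite expn0 expr1 mulr0 addr0 /poly_iter /= map_polyX !hornerX subrK.
rewrite horner_lift_poly_iterS IHn horner_poly_iterS.
set c := (poly_iter f n).[a].
have Ac : c \in A.
  rewrite /c; elim: (n) => [|i IHi]; first by rewrite hornerX.
  by rewrite horner_poly_iterS; apply: f_int.
have Bc := order_gen_const alpha Ac.
have [D DE] : exists D, ((2 * d) ^ n)%N = D.+1.
  by exists ((2 * d) ^ n).-1; rewrite prednK // expn_gt0 muln_gt0 expn_gt0.
pose T := t ^+ ((2 * d) ^ n); pose P := T + 2 * t * b.
have TE : T = t * t ^+ D by rewrite /T DE exprS.
have BT : T \in B by rpred_closed.
have BP : P \in B by rpred_closed.
have [b1 Bb1 e1] := exprD_pow2 k.+1 BP Bc.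
have B2tb : 2 * t * b \in B by rpred_closed.
have [b2 Bb2 e2] := exprD_pow2 k.+1 BT B2tb.
have [b3 Bb3 e3] := exprD_pow2 k BP Bc.
have [E EE] : exists E, d = E.+1 by exists d.-1; rewrite prednK // expn_gt0.
have [E' EE'] : exists E', (2 ^ k.+1)%N = E'.+1.
  by exists (2 ^ k.+1).-1; rewrite prednK // expn_gt0.
pose rho := t ^+ D + 2 * b.
have PE : P = t * rho by rewrite /P TE /rho; ring.
have Brho : rho \in B by rpred_closed.
rewrite -/T -/P horner_lift_f -expnS e1 e3.
have -> : P ^+ (2 ^ k.+1) = T ^+ (2 ^ k.+1) + (2 * t * b) ^+ (2 ^ k.+1) +
    2 * T * (2 * t * b) * b2 by exact: e2.
exists ((2 * t * b) ^+ E' * b + T * 2 * b * b2 + rho * iota c * b1 +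
   iota mu * (rho * P ^+ E + 2 * rho * iota c * b3)); first by rpred_closed.
rewrite horner_f rmorphD rmorphM !rmorphXn rmorphM (rmorph_nat iota 2).
have -> : (2 * t * b) ^+ (2 ^ k.+1) = 2 * t * b * (2 * t * b) ^+ E' by rewrite EE' exprS.
rewrite -expnS.
have -> : t ^+ ((2 ^ k.+1) ^ n.+1) = T ^+ (2 ^ k.+1) by rewrite -exprM expnSr -expnS.
have -> : P ^+ d = t * rho * P ^+ E by rewrite EE exprS -PE.
rewrite PE; move: (T ^+ (2 ^ k.+1)) (P ^+ E) (iota c ^+ _) (iota c ^+ _) ((2 * t * b) ^+ E') => x1 x2 x3 x4 x5.
by ring.
Qed.

Lemma order_gen_mod_t y : y \in B -> exists y0 b, [/\ y0 \in A, b \in B &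
  y = iota y0 + t * b].
Proof.
move=> /order_genP[q /polyOverP Aq ->].
have Ba := order_gen_const alpha Aa.
have [b Bb bE] : dvd_in B t ((lift q).[alpha] - iota q.[a]).
  rewrite -horner_map !horner_coef -sumrB.
  apply: dvd_in_sum => i; rewrite -mulrBr coef_map; apply: dvd_in_mull.
    exact: order_gen_const (Aq i).
  apply: dvd_in_subX => //; [exact: order_gen_alpha|exact: dvd_in_refl].
exists q.[a], b; split=> //; last by rewrite [t * b]mulrC -bE addrC subrK.
by apply: rpred_horner => //; apply/polyOverP.
Qed.

Variables (n : nat) (z : L).
Hypothesis n_gt0 : (0 < n)%N.
Hypothesis alpha_root : (lift (poly_iter f n)).[alpha] = iota a.
Hypothesis alphaNa : alpha != iota a.
Hypothesis B_int : {subset B <= integral_elt L}.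

(** By the expansion of the iterate, [- t ^+ D] is [2] times [eps], which is
    [u] modulo [(2, t)].  As [t] is nilpotent modulo [2], a geometric series
    inverts [eps] modulo [2]. *)
Lemma t_pow : exists eps eps' b, [/\ eps \in B, eps' \in B, b \in B,
  t ^+ ((2 * d) ^ n) = - (2 * eps) & eps * eps' = 1 + 2 * b].
Proof.
have Bt := order_gen_t; have B2 := subring_nat B 2.
have [b Bb] := iter_expansion n.
have [v Av iterE] := iter_congr4 n.-1; rewrite prednK // in iterE.
rewrite alpha_root iterE => tE; have [v' Av' uuE] := uu'.
pose eps := t * b + iota (u + 2 * v); pose D := ((2 * d) ^ n)%N.
have BC x : x \in A -> iota x \in B by exact: order_gen_const.
have Beps : eps \in B.
  rewrite /eps rmorphD rmorphM (rmorph_nat iota 2).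
  by have := (BC _ Au, BC _ Av) => -[? ?]; rpred_closed.
have tD : t ^+ D = - (2 * eps).
  apply: (addIr (2 * t * b + iota (a + 2 * u + 2 * 2 * v))); rewrite addrA -tE.
  have -> : iota (a + 2 * u + 2 * 2 * v) = iota a + 2 * iota (u + 2 * v).
    by rewrite !(rmorphD, rmorphM, rmorph_nat iota 2); ring.
  by rewrite /eps; ring.
have D_gt0 : (0 < D)%N by rewrite expn_gt0 muln_gt0 expn_gt0.
pose y := - (t * (b * iota u')).
have By : y \in B by have := BC _ Au' => ?; rpred_closed.
pose sigma := \sum_(i < D) y ^+ i.
have Bsig : sigma \in B by apply: rpred_sum => i _; rpred_closed.
have [c Bc yD] : exists2 c, c \in B & y ^+ D = 2 * c.
  rewrite /y -mulrN exprMn tD; exists (- eps * (- (b * iota u')) ^+ D).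
    by have := BC _ Au' => ?; rpred_closed.
  by ring.
have uuE' : iota u * iota u' = 1 + 2 * iota v'.
  rewrite -rmorphM -[u * u'](subrK 1) uuE rmorphD rmorph1 addrC rmorphM.
  by rewrite (rmorph_nat iota 2) mulrC.
have ey : eps * iota u' = (1 - y) + 2 * (iota v' + iota v * iota u').
  rewrite /eps rmorphD rmorphM (rmorph_nat iota 2) /y.
  have -> : (t * b + (iota u + 2 * iota v)) * iota u' =
     iota u * iota u' + t * (b * iota u') + 2 * (iota v * iota u') by ring.
  by rewrite uuE'; ring.
have := (BC _ Au', BC _ Av, BC _ Av') => -[[Bu' Bv] Bv'].
exists eps, (iota u' * sigma), (- c + (iota v' + iota v * iota u') * sigma).
split=> //; [by rpred_closed|by rpred_closed|].
rewrite mulrA ey mulrDl.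
have -> : (1 - y) * sigma = 1 - y ^+ D.
  by rewrite -[RHS]opprB subrX1 -mulNr opprB.
by rewrite yD; ring.
Qed.

(** Eisenstein descent: [t ^+ j * z] lies in [B] for large [j] as [t ^+ D] is
    [2] up to a unit modulo [2].  When [t ^+ j.+1 * z] lies in [B], its class
    modulo [t] is nilpotent by integrality, so it is [t * b1 + 2 * y1], and [2]
    is again a multiple of [t] up to that unit. *)
Lemma half_mem : z \in integral_elt L -> 2 * z \in B -> z \in B.
Proof.
move=> Az B2z; have [eps [eps' [b [Beps Beps' Bb tD epsE]]]] := t_pow.
have Bt := order_gen_t; have B2 := subring_nat B 2; pose D := ((2 * d) ^ n)%N.
have D_gt0 : (0 < D)%N by rewrite expn_gt0 muln_gt0 expn_gt0.
have t0 : t != 0 by rewrite subr_eq0.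
have BC x : x \in A -> iota x \in B by exact: order_gen_const.
have tDz : t ^+ D * z \in B.
  have -> : t ^+ D * z = - eps * (2 * z) by rewrite tD; ring.
  by rpred_closed.
elim: D tDz {D_gt0} => [|j IHj]; first by rewrite mul1r.
rewrite exprS -mulrA => By; apply: IHj.
have At : t \in integral_elt L by apply: B_int.
have [|r yr] := integral_pow_dvd Bt By; first by rpred_closed.
have [y0 [b1 [Ay0 Bb1 yE]]] := order_gen_mod_t By.
have By0 := BC _ Ay0.
have ty0 : dvd_in B t (iota y0 ^+ r).
  have -> : iota y0 ^+ r = (t * (t ^+ j * z)) ^+ r
      - ((t * (t ^+ j * z)) ^+ r - iota y0 ^+ r) by rewrite opprB addrC subrK.
  apply: dvd_in_sub => //; apply: dvd_in_subX => //.
  by exists b1 => //; rewrite yE addrAC subrr add0r mulrC.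
have [y1 Ay1 y0E] : dvd_in A 2 y0.
  apply: (reduced_mod_pow (r := r * (2 * d) ^ n) reduced_mod2 Ay0).
  have [q Bq qE] : dvd_in B 2 (iota (y0 ^+ (r * (2 * d) ^ n))).
    have [q Bq qE] := ty0; exists (- q ^+ ((2 * d) ^ n) * eps).
      by rpred_closed.
    by rewrite rmorphXn exprM qE exprMn tD; ring.
  by apply: (dvd_in_rmorph (phi := in_alg L) _ _ qE) => //; apply: B_int.
have [D DE] : exists D, ((2 * d) ^ n)%N = D.+1.
  by exists ((2 * d) ^ n).-1; rewrite prednK // expn_gt0 muln_gt0 expn_gt0.
have By1 := BC _ Ay1.
have epsz : eps * (t ^+ j * z) \in B.
  have -> : eps * (t ^+ j * z) = eps * b1 - t ^+ D * iota y1.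
    apply: (mulfI t0); rewrite mulrCA yE y0E rmorphM (rmorph_nat iota 2).
    have -> : t * (eps * b1 - t ^+ D * iota y1) = t * eps * b1 - t ^+ D.+1 * iota y1.
      by rewrite exprS; ring.
    by rewrite -DE tD; ring.
  by rpred_closed.
have -> : t ^+ j * z = eps' * (eps * (t ^+ j * z)) - b * t ^+ j * (2 * z).
  have -> : eps' * (eps * (t ^+ j * z)) = eps * eps' * (t ^+ j * z) by ring.
  by rewrite epsE; ring.
by rpred_closed.
Qed.

End AtTwo.

(** * Dynamics of [f] and monogenicity *)

Section Family.

Variables (k : nat) (K : fieldExtType rat) (mu : K).
Hypothesis k_gt0 : (0 < k)%N.
Hypothesis mu_prim : (4 * 2 ^ k - 2)%N.-primitive_root mu.
Hypothesis mu_gen : <<1; mu>>%VS = fullv.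
Local Notation A := (integral_elt K).
Local Notation d := (2 ^ k)%N.
Let m := (2 * d - 1)%N.
Let f : {poly K} := 'X^(2 * d) + (2 * mu) *: 'X^d.

Let d_gt1 : (1 < d)%N.
Proof. by rewrite -{1}(expn0 2) ltn_exp2l. Qed.

Lemma mu_pow : mu ^+ (2 * d) = - mu.
Proof.
have nE : (4 * d - 2 = m * 2)%N by rewrite /m; lia.
have : mu ^+ m ^+ 2 == 1 by rewrite -exprM -nE prim_expr_order.
rewrite sqrf_eq1 => /orP[|/eqP muN].
  rewrite -(expr0 mu) (eq_prim_root_expr mu_prim) nE mod0n modn_small.
    by rewrite /m; have := d_gt1; lia.
  by rewrite /m; have := d_gt1; lia.
have -> : (2 * d = m.+1)%N by rewrite /m; have := d_gt1; lia.
by rewrite exprSr muN mulN1r.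
Qed.

Lemma mu_sq_prim : m.-primitive_root (mu ^+ 2).
Proof.
have := exp_prim_root mu_prim 2; congr (primitive_root_of_unity _ _).
have nE : (4 * d - 2 = m * 2)%N by rewrite /m; lia.
by rewrite nE (gcdn_idPl _) ?dvdn_mull // mulnK.
Qed.

Lemma mu_sq_gen : <<1; mu ^+ 2>>%VS = fullv.
Proof.
have muE : mu = - (mu ^+ 2) ^+ d by rewrite -exprM mu_pow opprK.
apply/eqP; rewrite eqEsubv subvf -mu_gen sub_adjoin1v {1}muE rpredN.
by apply: rpredX; apply: memv_adjoin.
Qed.

Lemma mu_int : mu \in A.
Proof.
by rewrite -[mu]opprK -mu_pow rpredN exprM rpredX // (prim_root_integral mu_sq_prim).
Qed.

Let m_odd : ~~ (2 %| m)%N.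
Proof. by rewrite dvdn2 /m oddB /= ?oddM ?muln_gt0 ?expn_gt0. Qed.

Lemma frobenius2 z : z \in A -> dvd_in A 2 (z ^+ (2 * d) - z).
Proof.
move=> Az; rewrite -expnS.
apply: (frobenius_cyclotomic mu_sq_prim mu_sq_gen) => //.
have -> : (2 ^ k.+1 = m + 1)%N by rewrite expnS /m; have := d_gt1; lia.
by rewrite modnDl.
Qed.

Lemma frobenius_prime p z : prime p -> ~~ (p %| m)%N -> z \in A ->
  dvd_in A p%:R (z ^+ (p ^ totient m) - z).
Proof.
move=> p_pr pm Az; apply: (frobenius_cyclotomic mu_sq_prim mu_sq_gen) => //.
by apply: cyclic.Euler_exp_totient; rewrite prime_coprime.
Qed.

Lemma f_monic : f \is monic /\ size f = (2 * d).+1.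
Proof.
have sz : (size ((2 * mu) *: 'X^d : {poly K}) < size ('X^(2 * d) : {poly K}))%N.
  rewrite (leq_ltn_trans (size_scale_leq _ _)) // !size_polyXn ltnS.
  by have := d_gt1; lia.
by rewrite monicE lead_coefDl // size_polyDl // lead_coefXn size_polyXn.
Qed.

Lemma poly_iter_monic n : poly_iter f n \is monic /\ size (poly_iter f n) = ((2 * d) ^ n).+1.
Proof.
have [mf sf] := f_monic.
elim: n => [|n [mn sn]]; first by rewrite monicX size_polyX.
have s_gt0 : (0 < (2 * d) ^ n)%N by rewrite expn_gt0 muln_gt0 expn_gt0.
have mS : poly_iter f n.+1 \is monic.
  rewrite monicE poly_iterS lead_coef_comp ?sn ?ltnS //.
  by rewrite (monicP mf) (monicP mn) mul1r expr1n.
split=> //; have := size_comp_poly f (poly_iter f n); rewrite -poly_iterS sf sn /=.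
have : (0 < size (poly_iter f n.+1))%N by rewrite lt0n size_poly_eq0 monic_neq0.
by case: (size _) => //= s _ ->; rewrite expnS.
Qed.

Lemma f_int_coef : f \is a polyOver A.
Proof.
have A2 : 2 \in A := rpred_nat _ 2.
by rewrite rpredD ?rpredX ?polyOverX // polyOverZ ?rpredX ?polyOverX ?rpredM ?mu_int.
Qed.

Lemma poly_iter_int n : poly_iter f n \is a polyOver A.
Proof.
elim: n => [|n IHn]; first exact: polyOverX.
by rewrite poly_iterS polyOver_comp ?f_int_coef.
Qed.

Lemma eps_pow : (- mu ^+ 2) ^+ d = - mu.
Proof.
rewrite -mu_pow exprM; have -> : d = (2 * 2 ^ k.-1)%N by rewrite -expnS prednK.
by rewrite [LHS]exprM sqrrN [RHS]exprM.
Qed.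

Section Root.

Variables (L : fieldExtType K) (alpha : L) (a : K) (n : nat).
Hypothesis alpha_gen : <<1; alpha>>%VS = fullv.
Hypothesis alpha_root :
  (map_poly (in_alg L) (poly_iter f n)).[alpha] = in_alg L a.
Hypothesis dimL : \dim {:L} = ((2 * d) ^ n)%N.
Hypothesis Aa : a \in A.
Hypothesis a_red : reduced_mod A a.
Hypothesis amu_red : reduced_mod A (a + mu ^+ 2).
Local Notation iota := (in_alg L).
Local Notation g i := ((map_poly (in_alg L) (poly_iter f i)).[alpha]).

(** The equations are [(g ^+ d + mu) ^+ 2 = f (g) + mu ^+ 2], followed by the
    extraction of [k] square roots of [g ^+ d]; the point [- mu ^+ 2], fixed by
    [f], gives [(- mu ^+ 2) ^+ d = - mu]. *)
Lemma tower_stage j : (j <= n)%N ->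
  stage alpha (j * k.+1) (g (n - j)) (iota (- mu ^+ 2)).
Proof.
elim: j => [|j IHj] jn.
  rewrite subn0 alpha_root mul0n; apply: stage0 => //.
    by rewrite opprK.
  by rewrite rpredN rpredX ?mu_int.
have := IHj (ltnW jn); set i := (n - j.+1)%N.
have -> : (n - j = i.+1)%N by rewrite /i subnSK.
set y := g i => st; have yS : g i.+1 = (y ^+ d) ^+ 2 + 2 * iota mu * y ^+ d.
  by rewrite horner_lift_poly_iterS horner_lift_f -exprM [(d * 2)%N]mulnC.
have A0 : 0 \in A := rpred0 _; have Amu := mu_int.
have [mi si] := poly_iter_monic i; have Ai := poly_iter_int i.
have sX e : size (poly_iter f i ^+ e) = ((2 * d) ^ i * e).+1.
  have : (0 < size (poly_iter f i ^+ e))%N.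
    by rewrite lt0n size_poly_eq0 expf_neq0 // monic_neq0.
  by have := size_exp (poly_iter f i) e; rewrite si /=; case: (size _) => //= s ->.
have hX e : (map_poly (in_alg L) (poly_iter f i ^+ e)).[alpha] = y ^+ e.
  by rewrite rmorphXn horner_exp.
have e_gt0 r : (0 < (2 * d) ^ i * 2 ^ r)%N.
  by rewrite muln_gt0 !expn_gt0 muln_gt0 expn_gt0.
have lt_dim r s : (r + s = k)%N ->
    ((2 * d) ^ i * 2 ^ r * 2 ^ (j * k.+1 + s) < \dim {:L})%N.
  move=> rs; rewrite dimL -expnS -!expnM -!expnD ltn_exp2l // /i.
  have := subnK jn; nia.
pose E r := iota ((- mu ^+ 2) ^+ (2 ^ (k - r))).
have steps r : (r <= k)%N -> stage alpha (j * k.+1 + r.+1) (y ^+ (2 ^ (k - r))) (E r).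
  elim: r => [|r IHr] rk.
    rewrite addn1.
    apply: (@stage_step K L alpha alpha_gen _ _ _ (poly_iter f i ^+ d)
      ((2 * d) ^ i * d)%N mu mu 0 (y ^+ d + iota mu) _ _ st) => //.
    - exact: rpredX.
    - by have := lt_dim k 0%N (addn0 k); rewrite addn0.
    - by rewrite hX.
    - by rewrite addrK subn0.
    - by rewrite /E subn0 eps_pow rmorph0 sub0r rmorphN.
    - by right; rewrite yS rmorphN rmorphXn; ring.
    - by left; rewrite yS; ring.
    - by right; rewrite yS rmorph0 rmorphN rmorphXn; ring.
  have krE : (k - r = (k - r.+1).+1)%N by rewrite subnSK.
  rewrite addnS.
  apply: (@stage_step K L alpha alpha_gen _ _ _ (poly_iter f i ^+ (2 ^ (k - r.+1)))
    ((2 * d) ^ i * 2 ^ (k - r.+1))%N 0 0 ((- mu ^+ 2) ^+ (2 ^ (k - r.+1)))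
    (y ^+ (2 ^ (k - r.+1))) _ _ (IHr (ltnW rk))) => //.
  - exact: rpredX.
  - by apply: lt_dim; rewrite subnK.
  - by rewrite rpredX // rpredN rpredX.
  - by rewrite hX rmorph0 addr0.
  - by rewrite rmorph0 subr0.
  - by rewrite rmorph0 subr0.
  - by left; rewrite -exprM krE expnSr.
  - by left; rewrite rmorph0 expr0n subr0 -exprM krE expnSr.
  - by right; rewrite /E krE expnSr !exprM -rmorphXn.
have := steps k (leqnn k); rewrite /E subnn !expr1.
by rewrite mulSn addnC.
Qed.

End Root.

Let fin_res := finite_residues mu_sq_prim mu_sq_gen.

Lemma f_sub_even a : a \in A -> exists2 u, u \in A & f.[a] - a = 2 * u.
Proof.
move=> Aa; have [q Aq qE] := frobenius2 Aa.
exists (q + mu * a ^+ d); first by have := mu_int => ?; rpred_closed.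
by rewrite horner_f addrAC qE; ring.
Qed.

Lemma size_iter_sub n a : (0 < n)%N ->
  poly_iter f n - a%:P \is monic /\ size (poly_iter f n - a%:P) = ((2 * d) ^ n).+1.
Proof.
move=> n_gt0; have [mn sn] := poly_iter_monic n.
have lt : (size (- a%:P : {poly K}) < size (poly_iter f n))%N.
  rewrite size_polyN sn (leq_ltn_trans (size_polyC_leq1 _)) // ltnS.
  by rewrite expn_gt0 muln_gt0 expn_gt0.
by rewrite monicE lead_coefDl // size_polyDl // (monicP mn) sn.
Qed.

(** An integral element [z] of [K(alpha)] lies in [O_K[alpha]] up to a power of
    [2] by the tower, and the powers of [2] are removed one by one. *)
Theorem admissible_monogenic a : admissible mu f a -> dynamically_monogenic f a.
Proof.
move=> [/integral_eltP Aa irr sqa sqamu sq2] n n_gt0.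
have Amu := mu_int.
have Aamu : a + mu ^+ 2 \in A by rpred_closed.
have a_red : reduced_mod A a := fun w => squarefree_reduced fin_res Aa sqa (w := w).
have amu_red : reduced_mod A (a + mu ^+ 2) :=
  fun w => squarefree_reduced fin_res Aamu sqamu (w := w).
have [u Au fa] := f_sub_even Aa.
have d2_gt1 : (1 < 2 * d)%N by have := d_gt1; lia.
have [u' Au' uu'] : exists2 u', u' \in A & dvd_in A 2 (u * u' - 1).
  apply: (unit_mod2 fin_res d2_gt1) => //; first exact: frobenius2.
  by move=> P pP P2; rewrite -fa; apply: sq2.
have [mp sp] := size_iter_sub a n_gt0.
have Ap := poly_iter_int n.
have irrp := irr n n_gt0; split=> //.
  by move=> i; apply/integral_eltP; apply/polyOverP; rewrite rpredB ?polyOverC.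
have [L dimL [alpha /rootP root_al gen]] := irredp_FAdjoin irrp.
rewrite sp /= in dimL; exists L, alpha; split; first exact/rootP.
have alpha_root : (map_poly (in_alg L) (poly_iter f n)).[alpha] = in_alg L a.
  by move/eqP: root_al; rewrite rmorphB /= map_polyC !hornerE subr_eq0 => /eqP.
have Aalpha : alpha \in integral_elt L.
  apply: (@integral_elt_root _ (map_poly (in_alg L) (poly_iter f n - a%:P))).
  - exact: monic_map.
  - apply/polyOverP => i; rewrite coef_map integral_elt_rmorph.
    by apply/polyOverP; rewrite rpredB ?polyOverC.
  - exact/rootP.
have B_int : {subset order_gen alpha <= integral_elt L}.
  move=> _ /order_genP[q /polyOverP Aq ->]; apply: rpred_horner => //.
  by apply/polyOverP => i; rewrite coef_map integral_elt_rmorph.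
have alphaNa : alpha != in_alg L a.
  apply/eqP => e; have al1 : alpha \in 1%VS by rewrite e; apply/vlineP; exists a.
  move: dimL; rewrite -gen (Fadjoin_idP al1) dimv1 => dim1.
  by have := ltn_exp2r 1 (2 * d) n_gt0; rewrite -dim1 exp1n ltnn d2_gt1.
rewrite gen; apply/seteqP; split=> [z [q Aq zE]|z [_ /integral_eltP Az]] /=.
  split; first exact: memvf.
  apply/integral_eltP/B_int/order_genP; exists q => //.
  by apply/polyOverP => i; apply/integral_eltP.
have st := tower_stage gen alpha_root dimL Aa a_red amu_red (leqnn n).
rewrite subnn /poly_iter /= map_polyX hornerX in st.
have [N] := stage_final gen st Az.
elim: N => [|N IHN] BN; last first.
  apply: IHN; apply: (half_mem k_gt0 Amu Aa Au Au' frobenius2 fa uu' n_gt0) => //.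
    by rewrite rpredM // rpredX // (rpred_nat _ 2).
  by rewrite mulrA -exprS.
rewrite mul1r in BN; have /order_genP[q /polyOverP Aq ->] := BN.
by exists q => // i; apply/integral_eltP.
Qed.

End Family.

(** * Irreducibility of the iterates *)

Lemma irreducible_factor (F : fieldType) (p : {poly F}) : (1 < size p)%N ->
  exists2 q, irreducible_poly q & q %| p.
Proof.
have [s] := ubnP (size p); elim: s p => // s IHs p les p_gt1.
have [irr|red] := pselect (irreducible_poly p); first by exists p.
have [q [sq qp nqp]] : exists q : {poly F}, [/\ size q != 1, q %| p & ~~ (q %= p)].
  apply: contrapT => nq; apply: red; split=> // q sq qp.
  by apply: contrapT => /negP nqp; apply: nq; exists q.
have p0 : p != 0 by rewrite -size_poly_gt0 ltnW.
have q0 : q != 0 by apply: contraTneq qp => ->; rewrite dvd0p.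
have lt_qp : (size q < size p)%N.
  by rewrite ltn_neqAle dvdp_leq // andbT dvdp_size_eqp.
have [||r irr rq] := IHs q.
- by apply: leq_trans lt_qp _; rewrite -ltnS.
- by rewrite ltn_neqAle eq_sym sq size_poly_gt0.
by exists r => //; apply: dvdp_trans rq qp.
Qed.

Lemma splitting_exists (F : fieldType) (p : {poly F}) : p \is monic ->
  exists (E : fieldType) (phi : {rmorphism F -> E}) (rs : seq E),
    map_poly phi p = \prod_(r <- rs) ('X - r%:P).
Proof.
have [s] := ubnP (size p); elim: s F p => // s IHs F p les mp.
have [p1|p_gt1] := leqP (size p) 1.
  exists F, idfun, [::]; rewrite big_nil map_poly_id //.
  have s1 : size p == 1 by rewrite eqn_leq p1 size_poly_gt0 monic_neq0.
  have [c _ pE] := size_poly1P _ s1; move: mp.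
  by rewrite pE monicE lead_coefC => /eqP ->.
have [q irr qp] := irreducible_factor p_gt1.
have [L _ [z qz _]] := irredp_FAdjoin irr.
have : root (map_poly (in_alg L) p) z.
  by move: qp => /dvdpP[r ->]; rewrite rmorphM rootM qz orbT.
move=> /factor_theorem[r rE].
have mr : r \is monic.
  by have : map_poly (in_alg L) p \is monic; [exact: monic_map|rewrite rE monicMr // monicXsubC].
have [|E [phi [rs phiE]]] := IHs L r _ mr.
  move: les; rewrite -(size_map_poly (in_alg L)) rE.
  by rewrite size_Mmonic ?monicXsubC ?monic_neq0 // size_XsubC addn2 ltnS.
exists E, (phi \o in_alg L), (phi z :: rs).
by rewrite map_poly_comp rE rmorphM /= phiE rmorphB /= map_polyX map_polyC big_cons mulrC.
Qed.

Section Eisenstein.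

Variables (k : nat) (K : fieldExtType rat) (mu : K).
Hypothesis k_gt0 : (0 < k)%N.
Hypothesis mu_prim : (4 * 2 ^ k - 2)%N.-primitive_root mu.
Hypothesis mu_gen : <<1; mu>>%VS = fullv.
Local Notation A := (integral_elt K).
Local Notation d := (2 ^ k)%N.
Let f : {poly K} := 'X^(2 * d) + (2 * mu) *: 'X^d.

Lemma iter_expansion0 (E : fieldType) (phi : {rmorphism K -> E}) (y : E) n :
  y \in integral_elt E -> exists2 b, b \in integral_elt E &
    (map_poly phi (poly_iter f n)).[y] = y ^+ ((2 * d) ^ n) + 2 * y * b.
Proof.
move=> Ay; have A2 : 2 \in integral_elt E := rpred_nat _ 2.
have Amu : phi mu \in integral_elt E.
  by rewrite integral_elt_rmorph (mu_int k_gt0 mu_prim).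
elim: n => [|n [b Ab IHn]].
  by exists 0; rewrite ?rpred0 // /poly_iter /= map_polyX hornerX mulr0 addr0.
rewrite poly_iterS map_comp_poly horner_comp IHn.
set D := ((2 * d) ^ n)%N; have D_gt0 : (0 < D)%N by rewrite expn_gt0 muln_gt0 expn_gt0.
have fE (x : E) : (map_poly phi f).[x] = x ^+ (2 * d) + 2 * phi mu * x ^+ d.
  rewrite /f rmorphD /= map_polyXn map_polyZ map_polyXn rmorphM.
  by rewrite (rmorph_nat phi 2) !hornerE.
have [b1 Ab1 e1] : dvd_in (integral_elt E) (2 * y)
    ((y ^+ D + 2 * y * b) ^+ (2 * d) - (y ^+ D) ^+ (2 * d)).
  apply: dvd_in_subX; [by rpred_closed|by rpred_closed|].
  by rewrite addrAC subrr add0r; apply: dvd_in_mulr => //; apply: dvd_in_refl.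
pose P := y ^+ D + 2 * y * b; have AP : P \in integral_elt E by rpred_closed.
have PE : P = y * (y ^+ D.-1 + 2 * b).
  by rewrite /P -[in LHS](prednK D_gt0) exprS; ring.
exists (b1 + phi mu * (y ^+ D.-1 + 2 * b) * P ^+ d.-1); first by rpred_closed.
rewrite fE -/P -(prednK (_ : 0 < d)%N) ?expn_gt0 // [P ^+ _.+1]exprS {2}PE.
rewrite prednK ?expn_gt0 // -[P ^+ (2 * d)](subrK ((y ^+ D) ^+ (2 * d))) e1.
rewrite -exprM expnSr -/D; move: (P ^+ _) (y ^+ _.-1) (y ^+ (D * _)) => x1 x2 x3.
ring.
Qed.

(** Eisenstein: every root has a [D]-th power divisible by [2], so a monic factor
    [h] of positive degree has [h(0) ^+ D], and thus [h(0)], divisible by [2]; two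
    such factors would make [2 * c] divisible by [4]. *)
Lemma irreducible_iter c n : c \in A -> dvd_in A 2 (c - 1) -> (0 < n)%N ->
  irreducible_poly (poly_iter f n - (2 * c)%:P).
Proof.
move=> Ac c1 n_gt0; pose p := poly_iter f n - (2 * c)%:P.
have [mp sp] := size_iter_sub k_gt0 mu_prim (2 * c) n_gt0.
rewrite -/f -/p in mp sp *; pose D := ((2 * d) ^ n)%N.
have const_even h : h \is monic -> h %| p -> (1 < size h)%N -> dvd_in A 2 h.[0].
  move=> mh /dvdpP[h' pE] sh.
  have [E [phi [rs hE]]] := splitting_exists mh.
  have A2 : 2 \in integral_elt E := rpred_nat _ 2.
  have Aphic : phi c \in integral_elt E by rewrite integral_elt_rmorph.
  have rsP r : r \in rs -> r \in integral_elt E /\ dvd_in (integral_elt E) 2 (r ^+ D).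
    move=> rrs; have rp : root (map_poly phi p) r.
      by rewrite pE rmorphM /= rootM hE root_prod_XsubC rrs orbT.
    have Ar : r \in integral_elt E.
      apply: integral_elt_root rp; first exact: monic_map.
      apply/polyOverP => i; rewrite coef_map integral_elt_rmorph.
      apply/polyOverP; rewrite rpredB ?(poly_iter_int k_gt0 mu_prim) // polyOverC.
      by rewrite rpredM // (rpred_nat _ 2).
    split=> //; have [b Ab bE] := iter_expansion0 phi n Ar.
    move/rootP: rp; rewrite rmorphB /= map_polyC !hornerE bE -/D => /eqP.
    have phi2c : phi (2 * c) = 2 * phi c by rewrite rmorphM (rmorph_nat phi 2).
    rewrite subr_eq0 => /eqP/(fun e => etrans e phi2c) rE.
    exists (phi c - r * b); first by rpred_closed.
    by rewrite -[LHS](addrK (2 * r * b)) rE; ring.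
  have h0E : phi h.[0] = \prod_(r <- rs) - r.
    rewrite -horner_map /= rmorph0 hE horner_prod.
    by apply: eq_bigr => r _; rewrite !hornerE.
  have Ah0 : h.[0] \in A.
    rewrite -(integral_elt_rmorph phi) h0E big_seq; apply: rpred_prod => r /rsP[Ar _].
    by rewrite rpredN.
  have [rs0|[r [rs' rsE]]] : rs = [::] \/ exists r, exists rs', rs = r :: rs'.
    by case: (rs) => [|r rs']; [left|right; exists r, rs'].
    by move: sh; rewrite -(size_map_poly phi) hE rs0 big_nil size_poly1.
  have red2 : reduced_mod A 2 := reduced_mod2 (frobenius2 k_gt0 mu_prim mu_gen).
  apply: (reduced_mod_pow (r := D) red2 Ah0).
  have [q Aq qE] : dvd_in (integral_elt E) 2 (phi (h.[0] ^+ D)).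
    rewrite rmorphXn h0E rsE big_cons exprMn; apply: dvd_in_mulr.
      apply: rpredX; rewrite big_seq; apply: rpred_prod => s srs.
      by rewrite rpredN; have [] := rsP s; rewrite // rsE inE srs orbT.
    rewrite exprNn; apply: dvd_in_mull; first by rpred_closed.
    by have [] := rsP r; rewrite // rsE inE eqxx.
  exact: (dvd_in_rmorph (phi := phi) _ _ qE).
split; first by rewrite sp ltnS expn_gt0 muln_gt0 expn_gt0.
move=> q sq qp; have p0 : p != 0 by rewrite monic_neq0.
have q0 : q != 0 by apply: contraTneq qp => ->; rewrite dvd0p.
apply: contrapT => /negP nqp.
have lq0 : lead_coef q != 0 by rewrite lead_coef_eq0.
pose h := (lead_coef q)^-1 *: q.
have hq : h %= q by rewrite eqp_scale // invr_eq0.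
have mh : h \is monic by rewrite monicE lead_coefZ mulVf.
have hp : h %| p by rewrite (eqp_dvdl _ hq).
have [g gE] := dvdpP _ _ hp.
have mg : g \is monic by move: mp; rewrite gE monicMr.
have sh : (1 < size h)%N.
  by rewrite (eqp_size hq) ltn_neqAle eq_sym sq size_poly_gt0.
have sg : (1 < size g)%N.
  rewrite ltnNge; apply/negP => sg.
  have sg1 : size g == 1 by rewrite eqn_leq sg size_poly_gt0 monic_neq0.
  have [e _ gC] := size_poly1P _ sg1.
  case/negP: nqp; rewrite -(eqp_ltrans hq) gE gC.
  by move: mg; rewrite gC monicE lead_coefC => /eqP ->; rewrite mul1r eqpxx.
have [e Ae eE] := const_even h mh hp sh.
have [e' Ae' eE'] : dvd_in A 2 g.[0].
  by apply: const_even => //; rewrite gE dvdp_mulr.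
have p00 : p.[0] = - (2 * c).
  rewrite /p !hornerE; have -> : (poly_iter f n).[0] = 0; last by rewrite sub0r.
  elim: (n) => [|i IHi]; first by rewrite hornerX.
  by rewrite poly_iterS horner_comp IHi horner_f !expr0n !muln_eq0 !expn_eq0 /= mulr0 addr0.
have n20 := natr_field_neq0 K (isT : (0 < 2)%N).
have cE : c = - (e' * e) * 2.
  apply: (mulfI n20); rewrite -[LHS]opprK -p00 gE hornerM eE eE'; ring.
have c2 : dvd_in A 2 c by exists (- (e' * e)) => //; rewrite rpredN rpredM.
have : dvd_in A 2 (1 : K) by have := dvd_in_sub c2 c1; rewrite subKr.
by move=> /(@dvd_in_int K 2 1 isT).
Qed.

End Eisenstein.

(** * Norms on the lattice of integers *)

Section Lattice.

Variables (K : fieldExtType rat) (n : nat) (b : n.-tuple K).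
Hypothesis b_basis : integral_basis b.
Local Notation A := (integral_elt K).

Definition point (c : 'I_n -> int) : K := \sum_(i < n) b`_i *~ c i.

Lemma point_int c : point c \in A.
Proof.
have [_ Ab] := b_basis; apply/integral_eltP; rewrite Ab.
by exists c.
Qed.

Lemma pointP x : x \in A -> exists c, x = point c.
Proof. by have [_ Ab] := b_basis; move=> /integral_eltP; rewrite Ab. Qed.

Lemma point_coord c i : coord b i (point c) = (c i)%:~R.
Proof.
have [fb _] := b_basis; rewrite -(coord_sum_free (fun j => (c j)%:~R) i fb).
by congr (coord b i _); apply: eq_bigr => j _; rewrite scaler_int.
Qed.

Lemma point_inj c c' : point c = point c' -> c =1 c'.
Proof.
move=> e i; apply: (@intr_inj rat); by rewrite -!point_coord e.
Qed.

Lemma pointD c c' : point c + point c' = point (fun i => c i + c' i).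
Proof. by rewrite -big_split; apply: eq_bigr => i _; rewrite mulrzDr. Qed.

Lemma pointB c c' : point c - point c' = point (fun i => c i - c' i).
Proof. by rewrite -sumrB; apply: eq_bigr => i _; rewrite mulrzBr. Qed.

Lemma pointMz c (e : int) : point c *~ e = point (fun i => c i * e).
Proof. by rewrite /point mulrz_suml; apply: eq_bigr => i _; rewrite mulrzA. Qed.

Lemma point_sum s (v : 'I_s -> int) (E : 'I_s -> 'I_n -> int) :
  \sum_i (v i)%:~R * point (E i) = point (fun l => \sum_i v i * E i l).
Proof.
rewrite /point; under eq_bigr do rewrite mulr_sumr.
rewrite exchange_big; apply: eq_bigr => l _ /=.
rewrite -mulrzl rmorph_sum mulr_suml; apply: eq_bigr => i _.
by rewrite -[b`_l *~ _]mulrzl mulrA rmorphM.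
Qed.

Lemma basis_gt0 : (0 < n)%N.
Proof.
rewrite lt0n; apply/eqP => n0.
have [c] := pointP (rpred1 A); rewrite /point big1 => [/eqP|i _].
  by rewrite oner_eq0.
by have := ltn_ord i; rewrite [in X in (_ < X)%N]n0.
Qed.

(** The norm, as the determinant of the multiplication by [point c] on the basis:
    the adjugate matrix shows that it is a multiple of [point c], and its
    expansion that it is a form of degree [n] in the coordinates. *)
Lemma norm_exists : exists (C : nat) (N : ('I_n -> int) -> int),
  [/\ (0 < C)%N,
      forall c, dvd_in A (point c) (N c)%:~R,
      forall c, N c = 0 -> point c = 0 &
      forall c X, (forall i, `|c i| <= Posz X) -> `|N c| <= Posz (C * X ^ n)].
Proof.
have [fb _] := b_basis.
have Ab (i : 'I_n) : b`_i \in A.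
  have -> : b`_i = point (fun j => (j == i)%:R); last exact: point_int.
  rewrite /point (bigD1 i) //= eqxx mulr1z big1 ?addr0 // => j /negPf ->.
  by rewrite mulr0z.
have /choice[mul mulE] (i : 'I_n) : exists m : 'I_n -> 'I_n -> int,
    forall j : 'I_n, b`_i * b`_j = point (m j).
  have /choice[mi miE] (j : 'I_n) : exists c, b`_i * b`_j = point c.
    by apply: pointP; rewrite rpredM.
  by exists mi.
pose M (c : 'I_n -> int) : 'M[int]_n := \matrix_(j, l) \sum_i c i * mul i j l.
have ME c (j : 'I_n) : point c * b`_j = \sum_l (M c j l)%:~R * b`_l.
  rewrite /point mulr_suml.
  have E (i : 'I_n) : b`_i *~ c i * b`_j = (c i)%:~R * point (mul i j).
    by rewrite mulrzAl mulE mulrzl.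
  under eq_bigr do rewrite E; rewrite point_sum /point.
  by apply: eq_bigr => l _; rewrite mxE mulrzl.
pose S' : int := \sum_(i < n) \sum_(j < n) \sum_(l < n) `|mul i j l|.
pose S := absz S'.
have SE : Posz S = S'.
  by apply: gez0_abs; do 3!apply: sumr_ge0 => ? _.
exists (n`! * S ^ n).+1, (fun c => \det (M c)); split=> //.
- move=> c; have [e oneE] := pointP (rpred1 A).
  pose bv : 'cV[K]_n := \col_j b`_j; pose MK := map_mx intr (M c) : 'M[K]_n.
  have MKb : MK *m bv = point c *: bv.
    apply/matrixP => j z; rewrite !mxE ME; apply: eq_bigr => l _.
    by rewrite !mxE.
  have adj : (\det (M c))%:~R *: bv = point c *: (map_mx intr (\adj (M c)) *m bv).
    rewrite scalemxAr -MKb mulmxA -map_mxM mul_adj_mx.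
    by rewrite map_scalar_mx mul_scalar_mx.
  exists (\sum_(j < n) (map_mx intr (\adj (M c)) *m bv) j 0 *~ e j).
    apply: rpred_sum => j _; rewrite rpredMz // mxE; apply: rpred_sum => l _.
    by rewrite !mxE rpredM ?rpred_int.
  transitivity ((\det (M c))%:~R * point e); first by rewrite -oneE mulr1.
  rewrite [point e]/point mulr_sumr mulr_suml; apply: eq_bigr => j _.
  have := congr1 (fun v : 'cV_n => v j 0) adj; rewrite !mxE => bj.
  by rewrite mulrzAr bj -mulrzAr mulrC.
- move=> c detM; apply: contrapT => /eqP c0.
  have : \det (map_mx intr (M c) : 'M[rat]_n) == 0 by rewrite det_map_mx detM.
  move=> /det0P[v v0 vM].
  have : \sum_j v 0 j *: b`_j = 0.
    apply: (mulfI c0); rewrite mulr0 mulr_sumr.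
    have E (j : 'I_n) : point c * (v 0 j *: b`_j) =
        \sum_(l < n) (v 0 j * (M c j l)%:~R) *: b`_l.
      rewrite -scalerAr ME scaler_sumr; apply: eq_bigr => l _.
      by rewrite mulrzl -scaler_int scalerA.
    under eq_bigr do rewrite E; rewrite exchange_big big1 //= => l _.
    rewrite -scaler_suml.
    have := congr1 (fun u : 'rV_n => u 0 l) vM; rewrite !mxE.
    by under eq_bigr do rewrite mxE; move=> ->; rewrite scale0r.
  move=> vb0; case/negP: v0; apply/eqP/rowP => j; rewrite mxE.
  by rewrite -(coord_sum_free (fun j => v 0 j) j fb) vb0 linear0.
- move=> c X cX; rewrite (le_trans (ler_norm_sum _ _ _)) //.
  have Mjl j l : `|M c j l| <= S' * X.
    rewrite mxE (le_trans (ler_norm_sum _ _ _)) // mulr_suml ler_sum // => i _.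
    rewrite normrM mulrC ler_pM ?normr_ge0 // {cX}.
    rewrite (bigD1 j) //= (bigD1 l) //= -addrA lerDl addr_ge0 ?sumr_ge0 // => j' _.
    exact: sumr_ge0.
  apply: (@le_trans _ _ ((S' * X) ^+ n *+ n`!)).
    rewrite -card_Sn -sumr_const ler_sum // => s _.
    rewrite normrM normr_sign mul1r normr_prod.
    have -> : (S' * X) ^+ n = \prod_(i < n) (S' * X) by rewrite prodr_const card_ord.
    by apply: ler_prod => i _; rewrite normr_ge0 Mjl.
  have -> : (S' * X) ^+ n *+ n`! = Posz ((S * X) ^ n * n`!).
    by rewrite -SE -[RHS]natz natrM natrX natz PoszM mulr_natr.
  by rewrite lez_nat expnMn mulSn; lia.
Qed.

Lemma prime_ideal_int (p : nat) (Q : set K) (c : int) : prime p -> prime_ideal Q ->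
  Q p%:R -> Q c%:~R -> (p %| absz c)%N.
Proof.
move=> p_pr [iQ Q1 _] Qp Qc; apply/negPn/negP => pc; apply: Q1.
have [u [v uv]] := Bezoutz c p; have cop : coprime (absz c) p.
  by rewrite coprime_sym prime_coprime.
have -> : 1 = u%:~R * c%:~R + v%:~R * p%:R :> K.
  rewrite -[p%:R]/(p%:~R) -!rmorphM -rmorphD /= uv /gcdz /=.
  by rewrite (eqP cop).
by apply: ideal_add => //; apply: ideal_mull; rewrite ?rpred_int.
Qed.

(** By Frobenius, distinct primes above [p] do not contain each other, so for each
    of them some integer lies in all the others but not in it; these integers are
    linearly independent modulo [p]. *)
Lemma primes_above_bound (p q s : nat) (Q : 'I_s -> set K) : prime p -> (1 < q)%N ->
  (forall z, z \in A -> dvd_in A p%:R (z ^+ q - z)) ->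
  (forall i, prime_ideal (Q i)) -> (forall i, Q i p%:R) -> injective Q -> (s <= n)%N.
Proof.
move=> p_pr q_gt1 frob pQ Qp injQ; have p_gt0 := prime_gt0 p_pr.
have sep (i j : 'I_s) : exists x, i != j -> [/\ x \in A, Q j x & ~ Q i x].
  have [ij|_] := boolP (i != j); last by exists 0.
  have [iQi Qi1 _] := pQ i; have [iQj _ _] := pQ j.
  apply: contrapT => nx.
  have sub : Q j `<=` Q i.
    move=> x Qjx; apply: contrapT => Qix; apply: nx; exists x => _.
    by split=> //; apply: ideal_int Qjx.
  case/negP: ij; apply/eqP/injQ/seteqP; split=> // y Qiy.
  have Ay := ideal_int iQi Qiy.
  apply: contrapT => Qjy; apply: Qi1.
  have : Q j (y * (y ^+ q.-1 - 1)).
    apply: (ideal_dvd_mem iQj (Qp j)); have := frob y Ay; congr dvd_in.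
    by rewrite mulrBr mulr1 -exprS prednK // ltnW.
  have Ay1 : y ^+ q.-1 - 1 \in A by rpred_closed.
  move=> /(prime_ideal_mul (pQ j) Ay Ay1)[//|/sub Qi1].
  have -> : 1 = y * y ^+ q.-2 - (y ^+ q.-1 - 1).
    have q1E : q.-1 = q.-2.+1 by lia.
    by rewrite -exprS -q1E opprB addrC subrK.
  apply: ideal_sub => //; apply: ideal_mulr => //; exact: rpredX.
have /choice[x xP] (ij : 'I_s * 'I_s) : exists x,
    ij.1 != ij.2 -> [/\ x \in A, Q ij.2 x & ~ Q ij.1 x] by exact: sep.
pose e i := \prod_(j | i != j) x (i, j).
have Ae i : e i \in A by apply: rpred_prod => j /(xP (i, j))[].
have eQ i j : i != j -> Q j (e i).
  move=> ij; rewrite /e (bigD1 j) //=; have [iQ _ _] := pQ j.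
  have [_ Qx _] := xP (i, j) ij; apply: ideal_mulr => //.
  by apply: rpred_prod => l /andP[/(xP (i, l))[]].
have eNQ i : ~ Q i (e i).
  have [_ Qi1 _] := pQ i.
  suff [] : e i \in A /\ ~ Q i (e i) by [].
  apply: (big_rec (fun y => y \in A /\ ~ Q i y)); first by rewrite rpred1.
  move=> j y /(xP (i, j))[/= Ax _ Qx] [Ay Qy]; split; first exact: rpredM.
  by move=> /(prime_ideal_mul (pQ i) Ax Ay)[].
have /choice[E eE] (i : 'I_s) : exists c, e i = point c by apply: pointP.
pose M : 'M['F_p]_(s, n) := \matrix_(i, l) (E i l)%:~R.
have Fp0 (c : int) : (c%:~R == 0 :> 'F_p) = (p %| absz c)%N.
  rewrite [in LHS](intEsign c) rmorphM rmorph_sign mulf_eq0 signr_eq0 /=.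
  by rewrite (dvdn_pcharf (pchar_Fp p_pr)).
suff /eqP <- : row_free M by exact: rank_leq_col.
apply: inj_row_free => v vM; apply/rowP => i; rewrite mxE.
pose V j : int := Posz (v 0 j).
have vV j : v 0 j = (V j)%:~R by rewrite -[LHS]natr_Zp.
have [iQ _ _] := pQ i.
have QiV j : j != i -> Q i ((V j)%:~R * e j).
  by move=> ji; apply: ideal_mull => //; [exact: rpred_int|exact: eQ].
have Qsum : Q i (\sum_j (V j)%:~R * e j).
  under eq_bigr do rewrite eE; rewrite point_sum.
  have /choice[W WE] l : exists w : int, \sum_j V j * E j l = w * p.
    suff /dvdzP : (p %| \sum_j V j * E j l)%Z by [].
    rewrite dvdzE -Fp0 rmorph_sum /=; apply/eqP.
    have := congr1 (fun u : 'rV_n => u 0 l) vM; rewrite !mxE; apply: etrans.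
    by apply: eq_bigr => j _; rewrite mxE rmorphM vV.
  have -> : point (fun l => \sum_j V j * E j l) = point W * p%:R.
    rewrite mulr_natr pmulrn pointMz /point; apply: eq_bigr => l _.
    by rewrite WE.
  by apply: ideal_mull => //; apply: point_int.
have : Q i ((V i)%:~R * e i).
  have -> : (V i)%:~R * e i = \sum_j (V j)%:~R * e j - \sum_(j | j != i) (V j)%:~R * e j.
    by rewrite (bigD1 i) //= addrK.
  apply: ideal_sub => //; apply: (big_ind (Q i)) => //; first by case: iQ.
  by move=> ? ?; apply: ideal_add.
have AV : (V i)%:~R \in A by exact: rpred_int.
case/(prime_ideal_mul (pQ i) AV (Ae i)) => [QV|/eNQ//].
by have := prime_ideal_int p_pr (pQ i) (Qp i) QV; rewrite -Fp0 vV => /eqP.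
Qed.

(** An integer of the square of [Q] that [p ^ 2] does not divide would put [p] in
    this square, by Bezout. *)
Lemma norm_square_dvd (N : ('I_n -> int) -> int) (p : nat) (Q : set K) c :
  (forall c, dvd_in A (point c) (N c)%:~R) -> prime p -> prime_ideal Q -> Q p%:R ->
  ~ ideal_mul Q Q p%:R -> ideal_mul Q Q (point c) -> (p ^ 2 %| absz (N c))%N.
Proof.
move=> N_dvd p_pr pQ Qp pQQ QQc; have [iQ _ _] := pQ.
have iQQ := ideal_mul_ideal iQ iQ.
have QQN : ideal_mul Q Q (N c)%:~R := ideal_dvd_mem iQQ QQc (N_dvd c).
have QQ_Q : ideal_mul Q Q `<=` Q.
  apply: ideal_mul_sub; first by case: iQ.
    by move=> ? ?; apply: ideal_add.
  by move=> x y Qx Qy; apply: ideal_mulr => //; apply: (ideal_int iQ).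
have := prime_ideal_int p_pr pQ Qp (QQ_Q _ QQN).
move=> /(@dvdzP p (N c))[N' NE].
rewrite NE abszM expnS expn1 dvdn_pmul2r ?prime_gt0 //.
apply/negPn/negP => pN'; apply: pQQ; have [u [v uv]] := Bezoutz N' p.
have cop : coprime (absz N') p by rewrite coprime_sym prime_coprime.
have -> : p%:R = u%:~R * (N c)%:~R + v%:~R * (p%:R * p%:R) :> K.
  have : 1 = u%:~R * N'%:~R + v%:~R * p%:R :> K.
    by rewrite -[p%:R]/(p%:~R) -!rmorphM -rmorphD /= uv /gcdz /= (eqP cop).
  move=> /(congr1 (fun x => x * p%:R)); rewrite mul1r => {1}->.
  by rewrite NE rmorphM; ring.
apply: ideal_add => //; apply: ideal_mull; rewrite ?rpred_int //.
exact: ideal_mul_mem.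
Qed.

End Lattice.

(** * A congruence class of admissible elements *)

Lemma prime_ideal_prime (K : fieldExtType rat) (Q : set K) (x : K) :
  prime_ideal Q -> Q x -> x != 0 -> exists2 p, prime p & Q p%:R.
Proof.
move=> pQ Qx x0; have [iQ Q1 _] := pQ; have Ax := ideal_int iQ Qx.
have [c c_gt0 xc] := integral_dvd_nat Ax x0.
have : Q c%:R by apply: ideal_dvd_mem xc.
have [s] := ubnP c; elim: s c c_gt0 {xc} => // s IHs c c_gt0 cs Qc.
have c_gt1 : (1 < c)%N.
  rewrite ltn_neqAle c_gt0 andbT; apply/negP => /eqP c1; apply: Q1.
  by move: Qc; rewrite -c1.
have p_pr := pdiv_prime c_gt1.
move: Qc; rewrite -(divnK (pdiv_dvd c)) natrM.
have A_nat i : i%:R \in integral_elt K := rpred_nat _ i.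
move=> /(prime_ideal_mul pQ (A_nat _) (A_nat _))[Qc|Qp]; last by exists (pdiv c).
apply: (IHs (c %/ pdiv c)%N) => //.
  by rewrite divn_gt0 ?pdiv_gt0 // dvdn_leq // pdiv_dvd.
by rewrite -ltnS; apply: leq_trans cs; rewrite ltnS ltn_Pdiv // prime_gt1.
Qed.

Section Congruence.

Variables (k : nat) (K : fieldExtType rat) (mu : K).
Hypothesis k_gt0 : (0 < k)%N.
Hypothesis mu_prim : (4 * 2 ^ k - 2)%N.-primitive_root mu.
Hypothesis mu_gen : <<1; mu>>%VS = fullv.
Local Notation A := (integral_elt K).
Local Notation d := (2 ^ k)%N.
Let f : {poly K} := 'X^(2 * d) + (2 * mu) *: 'X^d.

(** The root of unity [w = mu ^+ 2] has odd order, so it is a power of [w ^+ 2] and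
    [1 - w] is a multiple of [1 - w ^+ 2]. *)
Lemma one_add_mu_sq_unit : exists2 v, v \in A & (1 + mu ^+ 2) * v = 1.
Proof.
have Amu := mu_int k_gt0 mu_prim; pose w := mu ^+ 2.
have d_gt1 : (1 < d)%N by rewrite -{1}(expn0 2) ltn_exp2l.
have wE : w = (w ^+ 2) ^+ d.
  by rewrite exprAC {2}/w -(exprM mu) mu_pow // sqrrN.
have w1 : w != 1.
  apply/negP => /eqP w1; have := prim_order_dvd (mu_sq_prim k_gt0 mu_prim) 1.
  by rewrite expr1 -/w w1 eqxx dvdn1 => /eqP; have := d_gt1; lia.
exists (\sum_(i < d) (w ^+ 2) ^+ i); first by apply: rpred_sum => i _; rpred_closed.
have w10 : w - 1 != 0 by rewrite subr_eq0.
apply: (mulfI w10); rewrite mulr1 -/w; transitivity ((w ^+ 2) ^+ d - 1).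
  by rewrite [RHS]subrX1 mulrA; congr (_ * _); ring.
by rewrite -wE.
Qed.

(* The class of [1 + M' ^ 2] modulo [4 * M'] is that of [2] modulo [4], as [M'] is
   odd, and that of [1] modulo [M']. *)
Variables (M' T : nat) (x : K).
Hypothesis M'_odd : odd M'.
Hypothesis M'_dvd : forall p, prime p -> odd p -> (p <= T)%N -> (p %| M')%N.
Hypothesis Ax : x \in A.
Let a : K := (1 + M' ^ 2)%:R + (4 * M')%:R * x.

Lemma class_even : exists2 c, c \in A /\ dvd_in A 2 (c - 1) & a = 2 * c.
Proof.
have [j M'E] : exists j, M' = j.*2.+1.
  by exists M'./2; rewrite -{1}[M']odd_double_half M'_odd.
have MRE : M'%:R = 1 + 2 * j%:R :> K by rewrite M'E -addn1 natrD -mul2n natrM addrC.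
have A2 := subring_nat A 2; have AM := subring_nat A M'; have Aj := subring_nat A j.
exists (1 + 2 * (j%:R ^+ 2 + j%:R + M'%:R * x)); first split; first by rpred_closed.
  by rewrite addrAC subrr add0r; apply: dvd_in_mulr (dvd_in_refl _ _); rpred_closed.
by rewrite /a natrD natrX natrM MRE; ring.
Qed.

Lemma class_int : a \in A.
Proof. by have [c [Ac _] ->] := class_even; rewrite rpredM ?(rpred_nat _ 2). Qed.

Let two_neq0 : 2 != 0 :> K := natr_field_neq0 K (isT : (0 < 2)%N).

Let two_unit : ~ dvd_in A 2 (1 : K).
Proof. by move=> /(@dvd_in_int K 2 1 isT). Qed.

Lemma class_neq0 : a != 0.
Proof.
have [c [Ac c1] ->] := class_even; rewrite mulf_neq0 //.
apply/negP => /eqP c0; apply: two_unit.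
by move: (dvd_in_opp c1); rewrite c0 sub0r opprK.
Qed.

Lemma mu_sq_inv : exists2 v, v \in A & mu ^+ 2 * v = 1.
Proof.
have Amu := mu_int k_gt0 mu_prim.
exists (mu ^+ (4 * d - 2 - 2)); first exact: rpredX.
rewrite -exprD -(prim_expr_order mu_prim); congr (_ ^+ _).
have : (1 < d)%N by rewrite -{1}(expn0 2) ltn_exp2l.
by move: (2 ^ k)%N => e; lia.
Qed.

Lemma class_add_mu_sq_neq0 : a + mu ^+ 2 != 0.
Proof.
have [c [Ac _] aE] := class_even; have [v Av muv] := mu_sq_inv.
apply/negP => /eqP amu0; apply: two_unit; exists (- c * v); first by rpred_closed.
transitivity (mu ^+ 2 * v); first by rewrite muv.
by rewrite -[mu ^+ 2](addKr a) amu0 aE; ring.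
Qed.

Let not_QQ2 (Q : set K) : prime_ideal Q -> Q 2 -> ~ ideal_mul Q Q 2.
Proof.
apply: (@unramified _ 2 (2 * d)) => //; last exact: (frobenius2 k_gt0 mu_prim mu_gen).
by have := expn_gt0 2 k; lia.
Qed.

Let not_QQa (Q : set K) c : prime_ideal Q -> Q 2 -> c \in A -> dvd_in A 2 (c - 1) ->
  ~ ideal_mul Q Q (2 * c).
Proof.
move=> pQ Q2 Ac [e Ae cE] QQc; have [iQ _ _] := pQ; apply: (not_QQ2 pQ Q2).
have iQQ := ideal_mul_ideal iQ iQ.
have -> : 2 = 2 * c - e * (2 * 2) by rewrite -[c](subrK 1) cE; ring.
by apply: ideal_sub => //; apply: ideal_mull => //; apply: ideal_mul_mem.
Qed.

(** By the choice of the class only the squares of primes above [p > T] may divide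
    [a] or [a + mu ^+ 2], which the hypothesis excludes. *)
Lemma class_admissible :
  (forall p (Q : set K) y, prime p -> prime_ideal Q -> Q p%:R -> (T < p)%N ->
     y = a \/ y = a + mu ^+ 2 -> ~ ideal_mul Q Q y) ->
  admissible mu f a.
Proof.
move=> good; have Aa := class_int; have Amu := mu_int k_gt0 mu_prim.
have Amu2 : mu ^+ 2 \in A by rpred_closed.
have [c [Ac c1] aE] := class_even.
have mu_unit Q : prime_ideal Q -> ~ Q (mu ^+ 2).
  move=> [iQ Q1 _] Qmu; apply: Q1; have [v Av <-] := mu_sq_inv.
  exact: ideal_mulr.
have sqf y : y = a \/ y = a + mu ^+ 2 -> y \in A -> y != 0 ->
    squarefree_ideal (principal y).
  move=> ya Ay y0; split.
    move=> y_eq; case/negP: y0; apply/eqP.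
    suff : principal y y by rewrite y_eq.
    by apply/principalE; apply: dvd_in_refl.
  move=> Q pQ QQy; have [iQ Q1 _] := pQ; have iQQ := ideal_mul_ideal iQ iQ.
  have {}QQy : ideal_mul Q Q y.
    by apply: (ideal_dvd_sub QQy iQQ); apply/principalE; apply: dvd_in_refl.
  have Qy : Q y.
    move: QQy; apply: (ideal_mul_sub (P := Q)); first by case: iQ.
      by move=> ? ?; apply: ideal_add.
    by move=> u v Qu Qv; apply: ideal_mulr => //; apply: ideal_int Qv.
  have [p p_pr Qp] := prime_ideal_prime pQ Qy y0.
  have [pT|pT] := leqP p T; last by apply: (good p Q y).
  have [p2|p_odd] := even_prime p_pr; last first.
    have /dvdnP[e ME] : (p %| M')%N by exact: M'_dvd.
    have AM := subring_nat A M'; have A4 := subring_nat A 4; have Ae := subring_nat A e.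
    have a1 : Q (a - 1).
      have -> : a - 1 = (e%:R * (M'%:R + 4%:R * x)) * p%:R.
        have MRE : M'%:R = e%:R * p%:R :> K by rewrite ME natrM.
        by rewrite /a natrD natrX natrM MRE; ring.
      by apply: ideal_mull => //; rpred_closed.
    apply: Q1; case: ya => yE.
      have -> : 1 = y - (a - 1) by rewrite yE; ring.
      exact: ideal_sub.
    have [v Av <-] := one_add_mu_sq_unit; apply: ideal_mulr => //.
    have -> : 1 + mu ^+ 2 = y - (a - 1) by rewrite yE; ring.
    exact: ideal_sub.
  rewrite p2 in Qp; have Qa : Q a by rewrite aE; apply: ideal_mulr.
  case: ya => yE; first by apply: (not_QQa pQ Qp Ac c1); rewrite -aE -yE.
  apply: (mu_unit Q pQ); have -> : mu ^+ 2 = y - a by rewrite yE addrC addKr.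
  exact: ideal_sub.
split.
- exact/integral_eltP.
- by move=> n n_gt0; rewrite aE; apply: irreducible_iter.
- by apply: sqf; [left| |exact: class_neq0].
- apply: sqf; [by right|by rpred_closed|exact: class_add_mu_sq_neq0].
move=> P pP P2; have [iP _ _] := pP; have iPP := ideal_mul_ideal iP iP.
have {}P2 : P 2.
  have : [set i : int | P i%:~R] 2 by rewrite P2 /=.
  by [].
move=> PPf; apply: (not_QQa pP P2 Ac c1).
have {}PPf : ideal_mul P P (f.[a] - a).
  by apply: (ideal_dvd_sub PPf iPP); apply/principalE; apply: dvd_in_refl.
have [s dE] : exists s, d = s.+1 by exists d.-1; rewrite prednK // expn_gt0.
have A2 := subring_nat A 2.
have -> : 2 * c = (2 * 2) * (c ^+ 2 * a ^+ (2 * s) + mu * c * a ^+ s) - (f.[a] - a).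
  rewrite horner_f -aE dE mulnS !exprD [a ^+ s.+1]exprS.
  have -> : a ^+ 2 = 2 * 2 * c ^+ 2 by rewrite aE; ring.
  have -> : 2 * mu * (a * a ^+ s) = 2 * 2 * mu * c * a ^+ s by rewrite {1}aE; ring.
  by move: (a ^+ (2 * s)) (a ^+ s) => X Y; ring.
apply: ideal_sub => //; apply: ideal_mulr => //; first exact: ideal_mul_mem.
by rpred_closed.
Qed.

End Congruence.

(** * The sieve *)

Lemma card_fibers (S T : finType) (P : pred S) (h : S -> T) (s : nat) :
  (forall y, (#|[pred t | P t && (h t == y)]| <= s)%N) -> (#|P| <= s * #|T|)%N.
Proof.
move=> fib; rewrite -sum1_card (partition_big h predT) //=.
rewrite mulnC -sum_nat_const; apply: leq_sum => y _.
by apply: leq_trans (fib y); rewrite -sum1_card.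
Qed.

(** Telescoping: [1 / (p + 1) ^ 2] is at most [1 / p - 1 / (p + 1)]. *)
Lemma sum_inv_square (T Z : nat) : (0 < T)%N -> (T <= Z)%N ->
  \sum_(T <= p < Z) (p.+1%:R ^- 2 : rat) <= T%:R^-1 - Z%:R^-1.
Proof.
move=> T_gt0; elim: Z => [|Z IHZ]; first by rewrite leqNgt T_gt0.
rewrite leq_eqVlt => /orP[/eqP ->|TZ]; first by rewrite big_geq // subrr.
rewrite ltnS in TZ; rewrite big_nat_recr //=.
apply: (le_trans (lerD (IHZ TZ) (lexx _))).
have Z_gt0 : (0 : rat) < Z%:R by rewrite ltr0n (leq_trans T_gt0).
rewrite -addrA lerD2l -natr1; set z : rat := Z%:R in Z_gt0 *.
rewrite -subr_ge0.
have -> : - (z + 1)^-1 - (- z^-1 + (z + 1) ^- 2) = (z * (z + 1) ^+ 2)^-1.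
  by field; lra.
rewrite invr_ge0 mulr_ge0 ?exprn_ge0; lra.
Qed.

(** The side [l] of the cells of the sieve is the largest one for which two
    points of a cell that are congruent modulo the square of a prime above [p]
    have to coincide. *)
Lemma cell_side (C n p X : nat) : (0 < C)%N -> (0 < n)%N -> (C < p ^ 2)%N ->
  exists l, [/\ (0 < l)%N, (C * l ^ n < p ^ 2)%N &
    (((X %/ l).+1 ^ n)%:R : rat) <= 2 ^+ n * (C%:R * 2 ^+ n * X%:R ^+ n / p%:R ^+ 2 + 1)].
Proof.
move=> C_gt0 n_gt0 Cp.
have exl : exists l, (C * l ^ n < p ^ 2)%N by exists 1%N; rewrite exp1n muln1.
have lmax l : (C * l ^ n < p ^ 2)%N -> (l <= p ^ 2)%N.
  move=> lp; apply: leq_trans (ltnW lp).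
  apply: (@leq_trans (l ^ n)); last by rewrite leq_pmull.
  by case: (l) => // i; rewrite -{1}(expn1 i.+1) leq_pexp2l.
case: (ex_maxnP exl lmax) => l lp lM.
have l_gt0 : (0 < l)%N by apply: lM; rewrite exp1n muln1.
exists l; split=> //.
have big : (p ^ 2 <= C * (2 ^ n * l ^ n))%N.
  rewrite leqNgt; apply/negP => lt; have := lM l.+1.
  rewrite ltnn => abs; suff : false by []; apply: abs.
  apply: leq_ltn_trans lt; rewrite leq_mul2l -expnMn leq_exp2r //.
  by rewrite mul2n -addnn -addn1 leq_add2l l_gt0 orbT.
have p_gt0 : (0 : rat) < p%:R ^+ 2.
  by rewrite -natrX ltr0n (leq_trans _ Cp).
have Xl : ((X %/ l) ^ n * p ^ 2 <= C * 2 ^ n * X ^ n)%N.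
  apply: (leq_trans (leq_mul (leqnn _) big)).
  have : ((X %/ l) ^ n * l ^ n <= X ^ n)%N by rewrite -expnMn leq_exp2r ?leq_divM.
  move: ((X %/ l) ^ n)%N (l ^ n)%N (X ^ n)%N (2 ^ n)%N => u v x y uv.
  rewrite mulnC -!mulnA leq_mul2l; apply/orP; right.
  by rewrite leq_mul2l mulnC uv orbT.
have step : ((X %/ l).+1 ^ n <= 2 ^ n * ((X %/ l) ^ n + 1))%N.
  case: (X %/ l)%N => [|u]; first by rewrite exp1n exp0n // muln1 expn_gt0.
  apply: (@leq_trans ((2 * u.+1) ^ n)).
    by rewrite leq_exp2r //; lia.
  by rewrite expnMn leq_mul2l addn1 leqnSn orbT.
apply: (@le_trans _ _ (2 ^ n * ((X %/ l) ^ n + 1))%:R); first by rewrite ler_nat.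
rewrite natrM natrX natrD ler_wpM2l ?exprn_ge0 // lerD2r ler_pdivlMr //.
by rewrite -!natrX -!natrM ler_nat.
Qed.

Section SquareMultiples.

Variables (K : fieldExtType rat) (n : nat) (b : n.-tuple K).
Hypothesis b_basis : integral_basis b.
Local Notation A := (integral_elt K).
Local Notation pt t := (point b (fun i => Posz (val (t i)))).
Variables (C : nat) (N : ('I_n -> int) -> int).
Hypothesis N_dvd : forall c, dvd_in A (point b c) (N c)%:~R.
Hypothesis N_eq0 : forall c, N c = 0 -> point b c = 0.
Hypothesis N_le : forall c X, (forall i, `|c i| <= Posz X) ->
  `|N c| <= Posz (C * X ^ n).

Definition square_multiple (p M X : nat) (y : K) : pred {ffun 'I_n -> 'I_X} :=
  fun t => `[< exists Q : set K,
    [/\ prime_ideal Q, Q p%:R & ideal_mul Q Q (y + M%:R * pt t)] >].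

(** Two points in a cell of side [l] attached to the same prime [Q] differ by an
    element of [Q ^ 2] whose norm is smaller than [p ^ 2], hence coincide. *)
Lemma card_square_multiple (p q M X l : nat) (y : K) : prime p -> (1 < q)%N ->
  (forall z, z \in A -> dvd_in A p%:R (z ^+ q - z)) -> ~~ (p %| M)%N ->
  (0 < l)%N -> (C * l ^ n < p ^ 2)%N ->
  (#|square_multiple p M (X := X) y| <= n * (X %/ l).+1 ^ n)%N.
Proof.
move=> p_pr q_gt1 frob pM l_gt0 lp.
have p0 : p%:R != 0 :> K := natr_field_neq0 K (prime_gt0 p_pr).
pose h (t : {ffun 'I_n -> 'I_X}) : {ffun 'I_n -> 'I_(X %/ l).+1} :=
  [ffun i => inord (t i %/ l)].
suff fib : forall c, (#|[pred t | square_multiple p M y t && (h t == c)]| <= n)%N.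
  by have := card_fibers fib; rewrite card_ffun !card_ord.
move=> c; set U := [pred t | _ & _].
have UP (i : 'I_#|U|) := enum_valP i.
have /choice[Q QP] (i : 'I_#|U|) : exists Q : set K, [/\ prime_ideal Q, Q p%:R &
    ideal_mul Q Q (y + M%:R * pt (enum_val i))].
  by have /andP[/asboolP] := UP i.
suff inj (Q0 : set K) (t t' : {ffun 'I_n -> 'I_X}) : prime_ideal Q0 -> Q0 p%:R ->
    ideal_mul Q0 Q0 (y + M%:R * pt t) -> ideal_mul Q0 Q0 (y + M%:R * pt t') ->
    h t = c -> h t' = c -> t = t'.
  apply: (primes_above_bound b_basis (Q := Q) p_pr q_gt1 frob).
  - by move=> i; have [] := QP i.
  - by move=> i; have [] := QP i.
  move=> i j Qij; apply: enum_val_inj.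
  have [pQ Qp QQi] := QP i; have [_ _] := QP j; rewrite -Qij => QQj.
  have /andP[_ /eqP hi] := UP i; have /andP[_ /eqP hj] := UP j.
  exact: (inj _ _ _ pQ Qp QQi QQj hi hj).
move: Q0 t t' {Q QP UP} => Q t t' pQ Qp QQt QQt' ht ht'.
have [iQ _ _] := pQ; have iQQ := ideal_mul_ideal iQ iQ.
pose e (u : 'I_n) : int := Posz (t u) - Posz (t' u).
have eE : pt t - pt t' = point b e by rewrite pointB.
have QQM : ideal_mul Q Q (M%:R * point b e).
  have -> : M%:R * point b e = (y + M%:R * pt t) - (y + M%:R * pt t').
    by rewrite -eE; ring.
  exact: ideal_sub.
have QQe : ideal_mul Q Q (point b e).
  have [u [v uv]] := Bezoutz M (p * p)%N.
  have cop : coprime M (p * p) by rewrite coprimeMr coprime_sym prime_coprime // pM.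
  have -> : point b e = u%:~R * (M%:R * point b e) + v%:~R * point b e * (p%:R * p%:R).
    have uv1 : u%:~R * M%:R + v%:~R * (p%:R * p%:R) = 1 :> K.
      rewrite -natrM -[M%:R]/(M%:~R) -[(p * p)%:R]/((p * p)%N%:~R).
      by rewrite -!rmorphM -rmorphD /= uv /gcdz /= (eqP cop).
    transitivity ((u%:~R * M%:R + v%:~R * (p%:R * p%:R)) * point b e).
      by rewrite uv1 mul1r.
    by ring.
  apply: ideal_add => //; apply: ideal_mull => //; first exact: rpred_int.
    by rewrite rpredM ?rpred_int ?(point_int b_basis).
  exact: ideal_mul_mem.
have ndvd := norm_square_dvd N_dvd p_pr pQ Qp (unramified q_gt1 p0 frob pQ Qp) QQe.
have e_le u : `|e u| <= Posz l.
  have htt : h t = h t' by rewrite ht ht'.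
  have := congr1 (fun g : {ffun 'I_n -> 'I_(X %/ l).+1} => val (g u)) htt.
  rewrite !ffunE /= !inordK ?ltnS ?leq_div2r ?(ltnW (ltn_ord _)) // => tt'.
  have := divn_eq (t u) l; have := divn_eq (t' u) l; rewrite tt'.
  have := ltn_pmod (t u) l_gt0; have := ltn_pmod (t' u) l_gt0; rewrite /e.
  move: (t' u %/ l * l)%N (t u %% l)%N (t' u %% l)%N => x1 x2 x3; lia.
have Ne0 : N e = 0.
  apply/eqP; rewrite -absz_eq0; apply/negPn/negP; rewrite -lt0n => Npos.
  have := dvdn_leq Npos ndvd; have := N_le e_le.
  rewrite -abszE lez_nat => le1 le2.
  by have := leq_ltn_trans (leq_trans le2 le1) lp; rewrite ltnn.
have pt_eq : pt t = pt t' by apply/eqP; rewrite -subr_eq0 eE (N_eq0 Ne0).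
by apply/ffunP => u; apply: val_inj; have [] := point_inj b_basis pt_eq u.
Qed.

End SquareMultiples.

Lemma sieve_arith (q s c x t z : rat) : 0 < t -> 0 <= x ->
  8 * q * (s * s) * c <= t -> 8 * q * s * z <= x ->
  2 * q * s * (c * s * x * t^-1 + z) <= x / 2.
Proof.
move=> t0 x0 ct zx.
have h : 8 * q * (s * s) * c * x / t <= x by rewrite ler_pdivrMr // [leRHS]mulrC ler_wpM2r.
have -> : 2 * q * s * (c * s * x * t^-1 + z) =
    (8 * q * (s * s) * c * x / t) / 4 + (8 * q * s * z) / 4 by field; rewrite gt_eqF.
lra.
Qed.

Section Count.

Variables (k : nat) (K : fieldExtType rat) (mu : K).
Hypothesis k_gt0 : (0 < k)%N.
Hypothesis mu_prim : (4 * 2 ^ k - 2)%N.-primitive_root mu.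
Hypothesis mu_gen : <<1; mu>>%VS = fullv.
Variables (n : nat) (b : n.-tuple K).
Hypothesis b_basis : integral_basis b.
Local Notation A := (integral_elt K).
Local Notation d := (2 ^ k)%N.
Local Notation m := (2 * d - 1)%N.
Local Notation pt t := (point b (fun i => Posz (val (t i)))).
Let f : {poly K} := 'X^(2 * d) + (2 * mu) *: 'X^d.

Lemma prod_odd_dvd T p : prime p -> odd p -> (p <= T)%N ->
  (p %| \prod_(i < T.+1 | odd i) i)%N.
Proof.
move=> p_pr p_odd pT; have lt : (p < T.+1)%N by [].
by rewrite (bigD1 (Ordinal lt)) //= dvdn_mulr.
Qed.

(** A cell of side [l] contains at most [2 * n] bad points for a prime [p], and up
    to a constant factor there are at most [X ^ n / p ^ 2 + 1] cells. *)
Lemma admissible_count : exists M a0 X0 : nat, (0 < M)%N /\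
  forall X, (X0 <= X)%N -> exists P : pred {ffun 'I_n -> 'I_X},
    (X ^ n <= 2 * #|P|)%N /\
    forall t, P t -> admissible mu f (a0%:R + M%:R * pt t).
Proof.
have n_gt0 := basis_gt0 b_basis.
have [C [N [C_gt0 N_dvd N_eq0 N_le]]] := norm_exists b_basis.
have Amu := mu_int k_gt0 mu_prim.
(* [T] exceeds [m], so that larger primes are unramified, and [C], so that cells
   have positive side; the middle term makes the sum over [p > T] of
   [1 / p ^ 2] account for at most a quarter of the cube. *)
pose T := (m + 8 * n * 4 ^ n * C + C + 1)%N.
pose M' := (\prod_(i < T.+1 | odd i) i)%N.
have M'_odd : odd M'.
  by rewrite /M'; elim/big_ind: _ => // x y ox oy; rewrite oddM ox.
pose a0 := (1 + M' ^ 2)%N; pose M := (4 * M')%N.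
have [e0 e0E] : exists c, a0%:R = point b c by apply: (pointP b_basis); rewrite rpred_nat.
have [e1 e1E] : exists c, a0%:R + mu ^+ 2 = point b c.
  by apply: (pointP b_basis); rewrite rpredD ?rpred_nat ?rpredX.
pose G := (\sum_i absz (e0 i) + \sum_i absz (e1 i))%N.
(* The norms of [a] and [a + mu ^+ 2], for [a] in the class and in the cube, are
   at most [C1 * X ^ n], hence smaller than [Z ^ 2]: the primes to sieve by are
   smaller than [Z], and their number times the additive constant is at most a
   quarter of the cube. *)
pose C1 := (C * (G + M) ^ n)%N; pose kap := (8 * n * 2 ^ n)%N.
have kap_gt0 : (0 < kap)%N by rewrite !muln_gt0 n_gt0 expn_gt0.
have M_gt0 : (0 < M)%N by rewrite /M muln_gt0 /=; apply: odd_gt0.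
exists M, a0, (kap + 4 * kap ^ 2 * C1)%N; split=> // X X0X.
have X_gt0 : (0 < X)%N.
  by apply: leq_trans X0X; apply: leq_trans kap_gt0 _; apply: leq_addr.
pose Xn := (X ^ n)%N; pose Z := (Xn %/ kap)%N.
have X_Xn : (X <= Xn)%N by rewrite /Xn -{1}(expn1 X) leq_pexp2l.
have kapZ : (kap * Z <= Xn)%N by rewrite mulnC leq_divM.
have Z2 : (C1 * Xn < Z ^ 2)%N.
  have lt : (Xn < kap * Z.+1)%N by rewrite mulnC ltn_ceil.
  have Z_gt0 : (0 < Z)%N.
    by rewrite divn_gt0 // (leq_trans _ X_Xn) // (leq_trans _ X0X) // leq_addr.
  have le : (4 * kap ^ 2 * C1 <= Xn)%N.
    by rewrite (leq_trans _ X_Xn) // (leq_trans _ X0X) // leq_addl.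
  have lt2 : (Xn < 2 * kap * Z)%N by apply: leq_trans lt _; nia.
  have Xn_gt0 : (0 < Xn)%N by rewrite (leq_trans X_gt0).
  have k4 : (0 < 4 * kap ^ 2)%N by rewrite muln_gt0 expn_gt0 kap_gt0.
  rewrite -(ltn_pmul2l k4) mulnA.
  apply: (@leq_ltn_trans (Xn * Xn)%N); first by rewrite leq_mul2r le orbT.
  apply: (@leq_trans ((2 * kap * Z) * (2 * kap * Z))%N); last by rewrite -mulnn; nia.
  by rewrite ltn_mul.
pose bad p t := square_multiple b p M (X := X) (a0%:R) t ||
   square_multiple b p M (X := X) (a0%:R + mu ^+ 2) t.
pose Bad (t : {ffun 'I_n -> 'I_X}) :=
  [exists j : 'I_Z, [&& (T <= j)%N, prime j.+1 & bad j.+1 t]].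
have frob p : prime p -> (T < p)%N -> [/\ (1 < p ^ totient m)%N,
    forall z, z \in A -> dvd_in A p%:R (z ^+ (p ^ totient m) - z) &
    ~~ (p %| M)%N].
  move=> p_pr Tp; have m_gt0 : (0 < m)%N.
    have : (0 < d)%N by rewrite expn_gt0.
    by lia.
  split.
  - rewrite -{1}(expn0 p) ltn_exp2l ?prime_gt1 // totient_gt0 //.
  - have pm : ~~ (p %| m)%N.
      by rewrite gtnNdvd // (leq_ltn_trans _ Tp) // /T -!addnA leq_addr.
    by move=> z; apply: (frobenius_prime k_gt0 mu_prim mu_gen p_pr pm).
  - rewrite Euclid_dvdM // negb_or; apply/andP; split.
      rewrite gtnNdvd //; apply: leq_trans Tp; rewrite /T.
      have c4 : (4 <= 8 * n * 4 ^ n * C)%N.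
        by have : (0 < 4 ^ n)%N; [rewrite expn_gt0|nia].
      by rewrite -addnA addnAC; lia.
    rewrite /M'; elim/big_ind: _ => [|x y px py|i i_odd].
    + by rewrite Euclid_dvd1.
    + by rewrite Euclid_dvdM // negb_or px.
    + by rewrite gtnNdvd ?odd_gt0 // (leq_ltn_trans _ Tp) // -ltnS.
exists (predC Bad); split; last first.
  move=> t /= nBad; apply: (class_admissible k_gt0 mu_prim mu_gen (T := T)) => //.
  - by move=> p p_pr p_odd pT; apply: prod_odd_dvd.
  - exact: (point_int b_basis).
  move=> p Q y p_pr pQ Qp Tp yE QQy; have [q_gt1 fr pM] := frob p p_pr Tp.
  have [c [yc c_le]] : exists c, y = point b c /\
      forall i, `|c i| <= Posz ((G + M) * X).
    have shift e : (forall i, absz (e i) <= G)%N ->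
        forall i, `|e i + Posz (val (t i)) * Posz M| <= Posz ((G + M) * X).
      move=> eG i; apply: le_trans (ler_normD _ _) _.
      rewrite -PoszM -!abszE -PoszD lez_nat absz_nat mulnDl leq_add //.
        by apply: leq_trans (eG i) _; rewrite leq_pmulr.
      by rewrite mulnC leq_mul2l (ltnW (ltn_ord _)) orbT.
    have ptM : M%:R * pt t = point b (fun i => Posz (val (t i)) * Posz M).
      by rewrite mulr_natl pmulrn pointMz.
    case: yE => ->.
      exists (fun i => e0 i + Posz (val (t i)) * Posz M); split.
        by rewrite -/a0 -/M ptM e0E pointD.
      apply: shift => i; rewrite /G (bigD1 i) //= -!addnA; exact: leq_addr.
    exists (fun i => e1 i + Posz (val (t i)) * Posz M); split.
      by rewrite -/a0 -/M addrAC e1E ptM pointD.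
    apply: shift => i; rewrite /G [X in (_ + X)%N](bigD1 i) //= addnCA; exact: leq_addr.
  have y0 : y != 0.
    have tA := point_int b_basis (fun i => Posz (val (t i))).
    case: yE => ->; first exact: (class_neq0 M'_odd tA).
    exact: (class_add_mu_sq_neq0 k_gt0 mu_prim M'_odd tA).
  have p0 : p%:R != 0 :> K := natr_field_neq0 K (prime_gt0 p_pr).
  have ndvd : (p ^ 2 %| absz (N c))%N.
    by apply: (norm_square_dvd N_dvd p_pr pQ Qp (unramified q_gt1 p0 fr pQ Qp)); rewrite -yc.
  have Npos : (0 < absz (N c))%N.
    rewrite lt0n absz_eq0; apply: contra_neq y0 => Nc0.
    by rewrite yc; apply: N_eq0.
  have pZ : (p < Z)%N.
    rewrite -(@ltn_exp2r _ _ 2) //; apply: leq_ltn_trans Z2.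
    apply: leq_trans (dvdn_leq Npos ndvd) _.
    by have := N_le _ _ c_le; rewrite -abszE lez_nat expnMn mulnA.
  case/negP: nBad; have lt : (p.-1 < Z)%N by apply: leq_ltn_trans pZ; apply: leq_pred.
  apply/existsP; exists (Ordinal lt); rewrite /= prednK ?prime_gt0 // p_pr /=.
  apply/andP; split; first by rewrite -ltnS prednK ?prime_gt0.
  apply/orP; case: yE QQy => -> QQy; [left|right]; apply/asboolP; exists Q; split=> //.
  by rewrite addrAC.
have card_bad p : prime p -> (T < p)%N ->
    (#|bad p|%:R : rat) <= 2 * n%:R * 2 ^+ n * (C%:R * 2 ^+ n * X%:R ^+ n / p%:R ^+ 2 + 1).
  move=> p_pr Tp; have [q_gt1 fr pM] := frob p p_pr Tp.
  have Cp : (C < p ^ 2)%N.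
    have CT : (C <= T)%N by rewrite /T -addnA (leq_trans (leq_addr 1 C)) ?leq_addl.
    by apply: leq_ltn_trans CT _; apply: leq_trans Tp _; rewrite -{1}(expn1 p) leq_pexp2l ?prime_gt0.
  have [l [l_gt0 lp cell_le]] := cell_side X C_gt0 n_gt0 Cp.
  have card y := card_square_multiple b_basis N_dvd N_eq0 N_le X y p_pr q_gt1 fr pM l_gt0 lp.
  have le2 : (#|bad p| <= 2 * (n * (X %/ l).+1 ^ n))%N.
    rewrite mul2n -addnn.
    apply: leq_trans (leq_add (card a0%:R) (card (a0%:R + mu ^+ 2))).
    by rewrite -cardUI leq_addr.
  have : (#|bad p|%:R : rat) <= (2 * (n * (X %/ l).+1 ^ n))%:R by rewrite ler_nat.
  move=> /le_trans; apply; rewrite !natrM mulrA -[leRHS]mulrA.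
  by rewrite ler_wpM2l ?mulr_ge0.
pose F (j : nat) : rat := 2 * n%:R * 2 ^+ n * (C%:R * 2 ^+ n * X%:R ^+ n / j.+1%:R ^+ 2 + 1).
have F_ge0 j : 0 <= F j.
  by rewrite /F !mulr_ge0 ?addr_ge0 ?divr_ge0 ?mulr_ge0 ?exprn_ge0.
have union : (#|Bad|%:R : rat) <= \sum_(T <= j < Z) F j.
  have le1 : (#|Bad| <= \sum_(j < Z | (T <= j)%N && prime j.+1) #|bad j.+1|)%N.
    under eq_bigr do rewrite -sum1_card big_mkcond.
    rewrite exchange_big -sum1_card big_mkcond leq_sum //= => t _.
    rewrite unfold_in; case: existsP => // -[j /and3P[Tj j_pr bj]].
    have tb : t \in bad j.+1 by exact: bj.
    by rewrite (bigD1 j) ?Tj //= tb.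
  have : (#|Bad|%:R : rat) <= (\sum_(j < Z | (T <= j)%N && prime j.+1) #|bad j.+1|)%:R.
    by rewrite ler_nat.
  move=> /le_trans; apply; rewrite natr_sum.
  rewrite (big_nat_widenl T 0) //= big_mkord.
  rewrite [leRHS](bigID (fun j : 'I_Z => prime j.+1)) /= -[leLHS]addr0.
  rewrite lerD ?sumr_ge0 //; apply: ler_sum => j /andP[Tj j_pr].
  exact: card_bad.
have sumF : \sum_(T <= j < Z) F j <= X%:R ^+ n / 2.
  have T_gt0 : (0 < T)%N by rewrite /T addn1.
  have S_le : \sum_(T <= j < Z) (j.+1%:R ^- 2 : rat) <= T%:R^-1.
    have [TZ|ZT] := leqP T Z; last by rewrite big_geq ?invr_ge0 // ltnW.
    apply: le_trans (sum_inv_square T_gt0 TZ) _.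
    by rewrite lerBlDr lerDl invr_ge0.
  have -> : \sum_(T <= j < Z) F j = 2 * n%:R * 2 ^+ n *
     (C%:R * 2 ^+ n * X%:R ^+ n * (\sum_(T <= j < Z) j.+1%:R ^- 2) + (Z - T)%:R).
    rewrite /F -mulr_sumr; congr (_ * _).
    by rewrite big_split /= sumr_const_nat -mulr_sumr.
  have TQ : (8 * n%:R * 4 ^+ n * C%:R : rat) <= T%:R.
    by rewrite -natrX -!natrM ler_nat /T -!addnA addnCA leq_addr.
  have ZQ : (8 * n%:R * 2 ^+ n * Z%:R : rat) <= X%:R ^+ n.
    by rewrite -!natrX -!natrM ler_nat.
  have T0 : (0 : rat) < T%:R by rewrite ltr0n.
  have XX0 : (0 : rat) <= X%:R ^+ n by rewrite exprn_ge0.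
  have ZT : ((Z - T)%:R : rat) <= Z%:R by rewrite ler_nat leq_subr.
  have e4 : (4 : rat) ^+ n = 2 ^+ n * 2 ^+ n by rewrite -exprMn.
  have n2 : 0 <= 2 * n%:R * 2 ^+ n :> rat by rewrite !mulr_ge0 ?exprn_ge0.
  apply: (@le_trans _ _ (2 * n%:R * 2 ^+ n *
     (C%:R * 2 ^+ n * X%:R ^+ n * T%:R^-1 + Z%:R))).
    by rewrite ler_wpM2l // lerD // ler_wpM2l // !mulr_ge0 ?exprn_ge0.
  by apply: sieve_arith => //; rewrite -e4.
have half : (2 * #|Bad| <= X ^ n)%N.
  have := le_trans union sumF; rewrite ler_pdivlMr // -natrX -natrM ler_nat.
  by rewrite mulnC.
have cE : (#|Bad| + #|predC Bad| = X ^ n)%N by rewrite cardC card_ffun !card_ord.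
move: half; rewrite -cE !mul2n -!addnn leq_add2l => half.
by rewrite leq_add2r.
Qed.

End Count.

(** * Density *)

Section Density.

Variables (K : fieldExtType rat) (n : nat) (b : n.-tuple K) (R : realType).
Hypothesis b_basis : integral_basis b.
Local Notation A := (integral_elt K).
Local Notation pt t := (point b (fun i => Posz (val (t i)))).
Local Notation box S B := [set a | S a /\ ratr (coord_norm b a) <= B].

Lemma coord_norm_le (c : 'I_n -> int) (B : R) : 0 <= B ->
  reflect (forall i, (absz (c i))%:R <= B) (ratr (coord_norm b (point b c)) <= B).
Proof.
have ratrE i : ratr `|coord b i (point b c)| = (absz (c i))%:R :> R.
  by rewrite (point_coord b_basis) -intr_norm ratr_int -abszE.
move=> B0; apply: (iffP idP) => [le i|le].
  apply: le_trans le; rewrite -ratrE ler_rat.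
  exact: (le_bigmax _ (fun i => `|coord b i (point b c)|)).
have : coord_norm b (point b c) = 0 \/
    exists i, coord_norm b (point b c) = `|coord b i (point b c)|.
  rewrite /coord_norm; elim/big_ind: _ => [|x y Hx Hy|i _]; [by left| |by right; exists i].
  by rewrite /Num.max; case: ifP.
by move=> [->|[i ->]]; [rewrite rmorph0|rewrite ratrE].
Qed.

Definition cube_point (beta : nat) (g : {ffun 'I_n -> 'I_(2 * beta).+1}) : K :=
  point b (fun i => Posz (val (g i)) - Posz beta).

Lemma box_cube (S : set K) (B : R) : 0 <= B -> S `<=` integers K ->
  box S B `<=` range (@cube_point (Num.truncn B)).
Proof.
move=> B0 SA x [/SA/integral_eltP/(pointP b_basis)[c ->]] /(coord_norm_le _ B0) le.
set beta := Num.truncn B.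
have cb i : (absz (c i) <= beta)%N by rewrite truncn_ge_nat.
exists [ffun i => inord (absz (c i + Posz beta))] => //.
rewrite /cube_point; congr (point b _); apply/funext => i.
rewrite ffunE /= inordK; last by have := cb i; lia.
by have := cb i; lia.
Qed.

Lemma box_finite (S : set K) (B : R) : 0 <= B -> S `<=` integers K ->
  finite_set (box S B).
Proof.
move=> B0 SA; apply: sub_finite_set (box_cube B0 SA) _.
by apply: finite_image; apply: finite_finset.
Qed.

Lemma box_count_le (B : R) : 0 <= B ->
  (box_count b (integers K) B <= (2 * Num.truncn B).+1 ^ n)%N.
Proof.
move=> B0; have sub := box_cube B0 (@subset_refl _ (integers K)).
have fin := box_finite B0 (@subset_refl _ (integers K)).
have <- : size (codom (@cube_point (Num.truncn B))) = ((2 * Num.truncn B).+1 ^ n)%N.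
  by rewrite size_codom card_ffun !card_ord.
apply: uniq_leq_size; first exact: finmap.fset_uniq.
move=> x; rewrite in_fset_set // inE => /sub[g _ <-]; exact: codom_f.
Qed.

Lemma box_count_ge (S : set K) (B : R) (X M a0 : nat) (e0 : 'I_n -> int)
    (P : pred {ffun 'I_n -> 'I_X}) : S `<=` integers K -> (0 < M)%N ->
  a0%:R = point b e0 -> (forall t, P t -> S (a0%:R + M%:R * pt t)) ->
  (\sum_i absz (e0 i) + M * X)%:R <= B -> (#|P| <= box_count b S B)%N.
Proof.
move=> SA M_gt0 a0E PS leB.
have B0 : 0 <= B by apply: le_trans leB; rewrite ler0n.
have aE (t : {ffun 'I_n -> 'I_X}) : a0%:R + M%:R * pt t =
    point b (fun i => e0 i + Posz (val (t i)) * Posz M).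
  by rewrite a0E mulr_natl pmulrn pointMz pointD.
have in_box (t : {ffun 'I_n -> 'I_X}) : P t -> box S B (a0%:R + M%:R * pt t).
  move=> Pt; split; first exact: PS.
  rewrite aE; apply/(coord_norm_le _ B0) => i; apply: le_trans leB; rewrite ler_nat.
  have le1 : (absz (e0 i) <= \sum_i absz (e0 i))%N by rewrite (bigD1 i) //= leq_addr.
  have le2 : (absz (Posz (val (t i)) * Posz M)%R <= M * X)%N.
    by rewrite abszM !absz_nat mulnC leq_mul2l (ltnW (ltn_ord _)) orbT.
  move: (\sum_i _)%N (M * X)%N (e0 i) (Posz _ * Posz M) le1 le2 => x1 x2 x3 x4.
  clear; lia.
rewrite cardE -(size_map (fun t : {ffun 'I_n -> 'I_X} => a0%:R + M%:R * pt t)).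
apply: uniq_leq_size.
  rewrite map_inj_uniq ?enum_uniq // => t t'; rewrite !aE => /(point_inj b_basis) e.
  apply/ffunP => i; apply: val_inj; have := e i => /addrI/mulIf.
  by rewrite eqz_nat -lt0n => /(_ M_gt0) [].
move=> x /mapP[t]; rewrite mem_enum => Pt ->.
rewrite in_fset_set; last exact: box_finite.
by rewrite inE; apply: in_box.
Qed.

(** For [X = B / H], with [H] the constant below, the cube of side [X] maps into the
    box of size [B], which has at most [(6 * H * X) ^ n] points. *)
Lemma positive_density_of_count (S : set K) (M a0 X0 : nat) : S `<=` integers K ->
  (0 < M)%N ->
  (forall X, (X0 <= X)%N -> exists P : pred {ffun 'I_n -> 'I_X},
    (X ^ n <= 2 * #|P|)%N /\ forall t, P t -> S (a0%:R + M%:R * pt t)) ->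
  positive_density R b S.
Proof.
move=> SA M_gt0 count; split=> //.
have [e0 e0E] : exists c, a0%:R = point b c by apply: (pointP b_basis); rewrite rpred_nat.
pose H := (\sum_i absz (e0 i) + M)%N.
have H_gt0 : (0 < H)%N by rewrite /H addn_gt0 M_gt0 orbT.
pose eps : R := (2 * (6 * H) ^ n)%:R^-1.
have eps_gt0 : 0 < eps.
  by rewrite invr_gt0 ltr0n muln_gt0 expn_gt0 muln_gt0 H_gt0.
apply: (@lt_le_trans _ _ eps%:E); first by rewrite lte_fin.
rewrite limf_einfE; apply: le_ereal_sup_tmp.
pose V : set R := [set B | (H * X0.+1)%:R < B].
exists (ereal_inf ((fun B : R =>
  ((box_count b S B)%:R / (box_count b (integers K) B)%:R : R)%:E) @` V)).
  exists V => //; exists (H * X0.+1)%:R; split=> //; exact: num_real.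
apply: le_ereal_inf_tmp => _ [B /= HB <-]; rewrite lee_fin.
have H0 : (0 : R) < H%:R by rewrite ltr0n.
have B0 : 0 <= B by apply: le_trans (ltW HB); rewrite ler0n.
have BH0 : 0 <= B / H%:R by rewrite divr_ge0 // ltW.
pose X := Num.truncn (B / H%:R).
have /andP[X_le X_lt] : X%:R <= B / H%:R < X.+1%:R := truncn_itv BH0.
have X0X : (X0.+1 <= X)%N.
  by rewrite /X truncn_ge_nat // ler_pdivlMr // mulrC -natrM ltW.
have X_gt0 : (0 < X)%N by apply: leq_trans X0X.
have [P [cardP PS]] := count X (ltnW X0X).
have HX : (H * X)%:R <= B by move: X_le; rewrite ler_pdivlMr // mulrC -natrM.
have num_ge : (#|P| <= box_count b S B)%N.
  apply: (box_count_ge SA M_gt0 e0E PS); apply: le_trans HX; rewrite ler_nat.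
  by rewrite /H mulnDl leq_add2r leq_pmulr.
have den_le : (box_count b (integers K) B <= (6 * H * X) ^ n)%N.
  apply: leq_trans (box_count_le B0) _.
  rewrite leq_exp2r ?(basis_gt0 b_basis) //.
  have /andP[tB _] := truncn_itv B0.
  have : ((Num.truncn B)%:R : R) < (H * X.+1)%:R.
    by apply: le_lt_trans tB _; move: X_lt; rewrite ltr_pdivrMr // mulrC -natrM.
  rewrite ltr_nat; move: H_gt0 X_gt0; clear.
  by move: (Num.truncn B) => x; nia.
have num_le_den : (box_count b S B <= box_count b (integers K) B)%N.
  apply: finmap.fsubset_leq_card; rewrite -fset_set_sub; last 2 first.
  - exact: box_finite.
  - exact: (box_finite B0 (@subset_refl _ _)).
  by move=> x [/SA Ax le].
have Xn_gt0 : (0 < X ^ n)%N by rewrite expn_gt0 X_gt0.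
have num_gt0 : (0 < box_count b S B)%N.
  by apply: leq_trans num_ge; move: cardP; case: #|P| => //; rewrite muln0 leqn0 eqn0Ngt Xn_gt0.
rewrite ler_pdivlMr ?ltr0n ?(leq_trans num_gt0) //.
rewrite /eps ler_pdivrMl ?ltr0n ?muln_gt0 ?expn_gt0 ?muln_gt0 ?H_gt0 //.
rewrite -natrM ler_nat; apply: leq_trans den_le _.
rewrite expnMn [leqRHS]mulnAC [leqRHS]mulnC leq_mul2l; apply/orP; right.
by apply: leq_trans cardP _; rewrite leq_mul2l num_ge.
Qed.

End Density.

Theorem theorem4p11 (R : realType) (k : nat) (k_ge1 : (1 <= k)%N)
    (K : fieldExtType rat) (mu : K)
    (mu_prim : (4 * 2 ^ k - 2)%N.-primitive_root mu)
    (K_gen : <<1; mu>>%VS = fullv) :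
  let d := (2 ^ k)%N in
  let f : {poly K} := 'X^(2 * d) + (2 * mu) *: 'X^d in
  (forall (n : nat) (b : n.-tuple K),
     integral_basis b -> positive_density R b (admissible mu f))
  /\
  (forall a : K, admissible mu f a -> dynamically_monogenic f a).
Proof.
move=> d f; split; last exact: admissible_monogenic.
move=> n b b_basis.
have [M [a0 [X0 [M_gt0 count]]]] := admissible_count k_ge1 mu_prim K_gen b_basis.
apply: (positive_density_of_count R b_basis (X0 := X0) _ M_gt0 count).
by move=> a [].
Qed.
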